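(* Let $f:\mathbb{R}\to\mathbb{R}$ be a real analytic function of period $1$. Suppose $\alpha\in\Omega$ and $\gamma(E,\alpha)>0$ for Lebesgue almost every $E$. Then for any $\delta>0$ there exist a set $A(\delta)\subset S(\alpha)$ with $|A(\delta)|<\delta$ and constants $h(\alpha,\delta)>0$, $c(\alpha,\delta)>0$ such that for any $E\in S(\alpha)\setminus A(\delta)$ and any real $\alpha'$ with $|\alpha-\alpha'|<h(\alpha,\delta)$ there exists $E'\in S(\alpha')$ with $$|E'-E|<c(\alpha,\delta)\,\bigl|(\alpha-\alpha')\ln^3|\alpha-\alpha'|\bigr|.$$ The constant $c$ is independent of $E$, $E'$, $\alpha'$.
   Context: For $\alpha,\theta\in\mathbb{R}$, $H_{\alpha,\theta}$ is the operator on $\ell^2(\mathbb{Z})$ given by $(H_{\alpha,\theta}\psi)(n)=\psi(n-1)+\psi(n+1)+f(\alpha n+\theta)\psi(n)$; $S(\alpha,\theta)$ is its spectrum and $S(\alpha)=\bigcup_{\theta\in\mathbb{R}}S(\alpha,\theta)$. $|\cdot|$ is Lebesgue measure. $\Omega$ is the set of irrational $\alpha$ whose continued fraction coefficients $a_1,a_2,\dots$ form a bounded sequence. With $M_n(\theta,E)=\begin{pmatrix}E-f(\alpha n+\theta)&-1\\1&0\end{pmatrix}$ and $T_n=M_{n-1}\cdots M_0$, the Lyapunov exponent is $\gamma(E,\alpha)=\lim_{n\to\infty}\frac1n\int_0^1\ln\|T_n(\theta,E)\|\,d\theta$. *)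

(* Defs.v *)
From HB Require Import structures.
From mathcomp Require Import all_boot all_order all_algebra.
From mathcomp Require Import all_classical all_reals all_analysis.
Set Implicit Arguments. Unset Strict Implicit. Unset Printing Implicit Defensive.
Import Order.TTheory GRing.Theory Num.Theory.
Import numFieldNormedType.Exports.
Local Open Scope classical_set_scope.
Local Open Scope ring_scope.

Section Defs.
Variable R : realType.

Definition periodic1 (f : R -> R) : Prop := forall x, f (x + 1) = f x.

Definition real_analytic (f : R -> R) : Prop :=
  forall x0 : R, exists2 r : R, 0 < r &
    exists a : nat -> R, forall x : R, `|x - x0| < r ->
      series (fun k => a k * (x - x0) ^+ k) @ \oo --> f x.

Definition irrational (x : R) : Prop := forall q : rat, x != ratr q.

Definition fracpart (x : R) : R := x - (Num.floor x)%:~R.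
Fixpoint gauss_iter (x : R) (k : nat) : R :=
  match k with
  | 0 => fracpart x
  | k.+1 => fracpart (1 / gauss_iter x k)
  end.
(** continued fraction coefficient a_{k+1} of x = [a_0; a_1, a_2, ...] *)
Definition cf_coef (x : R) (k : nat) : int := Num.floor (1 / gauss_iter x k).

Definition Omega : set R :=
  [set x | irrational x /\ exists M : int, forall k, cf_coef x k <= M].

Definition sqnorm (psi : int -> R) : \bar R := \esum_(n in [set: int]) ((psi n) ^+ 2)%:E.
Definition l2 (psi : int -> R) : Prop := (sqnorm psi < +oo)%E.

Definition Hop (f : R -> R) (alpha theta : R) (psi : int -> R) : int -> R :=
  fun n => psi (n - 1)%R + psi (n + 1)%R + f (alpha * n%:~R + theta) * psi n.

Definition resolvent (f : R -> R) (alpha theta E : R) : Prop :=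
  exists G : (int -> R) -> (int -> R), exists C : R,
    forall psi, l2 psi ->
      [/\ l2 (G psi),
          (fun n => Hop f alpha theta (G psi) n - E * G psi n) = psi,
          G (fun n => Hop f alpha theta psi n - E * psi n) = psi &
          (sqnorm (G psi) <= (C ^+ 2)%:E * sqnorm psi)%E].

Definition spec (f : R -> R) (alpha theta : R) : set R :=
  [set E | ~ resolvent f alpha theta E].
Definition spec_union (f : R -> R) (alpha : R) : set R :=
  [set E | exists theta : R, spec f alpha theta E].

Definition Mtr (f : R -> R) (alpha : R) (n : nat) (theta E : R) : 'M[R]_2 :=
  \matrix_(i < 2, j < 2)
    (if (i == 0) && (j == 0) then E - f (alpha * n%:R + theta)
     else if (i == 0) && (j == 1) then -1
     else if (i == 1) && (j == 0) then 1 else 0).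
Fixpoint Ttr (f : R -> R) (alpha : R) (n : nat) (theta E : R) : 'M[R]_2 :=
  match n with
  | 0 => 1%:M
  | n.+1 => Mtr f alpha n theta E *m Ttr f alpha n theta E
  end.

Definition lyap_seq (f : R -> R) (alpha E : R) (n : nat) : R :=
  (n%:R)^-1 * Rintegral lebesgue_measure `[0%R, 1%R]
                (fun theta => ln `|Ttr f alpha n theta E|).

Definition lyap_pos (f : R -> R) (alpha E : R) : Prop :=
  exists2 L : R, 0 < L & lyap_seq f alpha E n @[n --> \oo] --> L.

End Defs.

(* Main.v *)
Require Import Defs.
From HB Require Import structures.
From mathcomp Require Import all_boot all_order all_algebra.
From mathcomp Require Import all_classical all_reals all_analysis.
From mathcomp Require Import ring lra zify.
Set Implicit Arguments. Unset Strict Implicit. Unset Printing Implicit Defensive.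
Import Order.TTheory GRing.Theory Num.Theory.
Import numFieldNormedType.Exports.
Local Open Scope classical_set_scope.
Local Open Scope ring_scope.

(** Let [h = H_{alpha,theta} - E].  By self-adjointness, [E] is within [e] of the
    spectrum as soon as some finitely supported [chi] satisfies
    [|h chi| <= e |chi|], and a change of [alpha] by [eps] costs at most
    [Lip(f) * eps * length(supp chi)] in [|h chi|] after adjusting [theta].  So
    it suffices to find approximate eigenvectors of precision [O(eps)] that live
    on intervals of length [O(|ln eps| ^ 3)].

    If [gamma(E, alpha) > 0], the transfer matrix [T_n] exceeds [exp(n / m)] on a
    set of phases which every orbit segment of length [m n^2] visits: by
    analyticity the entries of [T_n] are, on boundedly many intervals, close to
    polynomials of degree [O(n^2)], so that the phases with large [T_n] contain
    a cell of length of order [n^-2] (a polynomial has few roots, hence few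
    cells are mixed), and the orbits of [alpha] in [Omega] are equidistributed at
    the optimal rate.  Outside a set of small measure, [m] is uniform in [E].

    Halving such an interval of length [n = 2 ^ j] repeatedly gives a point [x]
    where [|B A| >= eps^-1 max(|A|, |B|)] for the transfer matrices [A] and [B] to
    the left and to the right of [x], provided [exp(n / m)] exceeds [eps ^ -j] up
    to a constant, i.e. [n] of order [|ln eps| ^ (3/2)].  At [x] every approximate
    solution is smaller by a factor [eps] than near the ends of the interval, so
    it can be cut there; one of the pieces is the required vector. *)

(** The spectrum enters through a single criterion: [E] belongs to it exactly when [H - E] is not
    bounded below on finitely supported vectors. This criterion and the distance estimate are
    obtained from real quadratic forms in [(H - E) ^ 2].

    Nothing is known about the decay of approximate eigenvectors, and cutting one produces an error
    constant that is exponentially large in the length of the interval. This is harmless: for [E] in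
    the spectrum the vector may be chosen after that constant, with a defect as small as desired, so
    that the precision of the pieces is governed by the barrier alone.

    The degree of order [n ^ 2] arises from [n] factors, each of which must be approximated with
    degree of order [n] for the error to survive the exponential growth of the product. It dictates
    the number of cells, hence the length of the orbit segment to be searched, and finally the cube
    of the logarithm. *)

(** * Sums of finitely supported functions *)

Section FiniteSums.
Variables (R : realType) (T : choiceType).
Implicit Types (F G : T -> R) (r : seq T).

Definition fsupp F : Prop := exists r, forall i, i \notin r -> F i = 0.

(** By convention [0] when the support is infinite; hence the [fsupp] hypotheses for additivity and
    monotonicity. *)
Definition fsum F : R := \sum_(i \in [set: T]) F i.

Lemma fsum_seq r F : uniq r -> (forall i, i \notin r -> F i = 0) ->
  fsum F = \sum_(i <- r) F i.
Proof.
move=> ur rF; rewrite (@bigfs _ _ _ _ r xpredT) // => [|i _]; last exact: rF.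
by apply: eq_fsbigl; apply/seteqP; split.
Qed.

Lemma fsupp_sub F G : fsupp F -> (forall i, F i = 0 -> G i = 0) -> fsupp G.
Proof. by move=> [r rF] FG; exists r => i /rF /FG. Qed.

Lemma fsupp2_seq F G : fsupp F -> fsupp G ->
  exists r, [/\ uniq r, forall i, i \notin r -> F i = 0 & forall i, i \notin r -> G i = 0].
Proof.
move=> [r rF] [s sG]; exists (undup (r ++ s)); rewrite undup_uniq.
by split=> // i; rewrite mem_undup mem_cat negb_or => /andP[? ?]; [apply: rF | apply: sG].
Qed.

Lemma fsuppD F G : fsupp F -> fsupp G -> fsupp (fun i => F i + G i).
Proof.
move=> fF fG; have [r [_ rF rG]] := fsupp2_seq fF fG.
by exists r => i ri; rewrite rF // rG // addr0.
Qed.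

Lemma fsuppMl F G : fsupp F -> fsupp (fun i => F i * G i).
Proof. by move=> /fsupp_sub; apply => i ->; rewrite mul0r. Qed.

Lemma fsuppMr F G : fsupp G -> fsupp (fun i => F i * G i).
Proof. by move=> /fsupp_sub; apply => i ->; rewrite mulr0. Qed.

Lemma fsumD F G : fsupp F -> fsupp G ->
  fsum (fun i => F i + G i) = fsum F + fsum G.
Proof.
move=> fF fG; have [r [ur rF rG]] := fsupp2_seq fF fG.
rewrite !(@fsum_seq r) // ?big_split // => i ri.
by rewrite rF // rG // addr0.
Qed.

Lemma fsumZ a F : fsum (fun i => a * F i) = a * fsum F.
Proof. by rewrite /fsum mulr_fsumr. Qed.

Lemma fsum_le F G : fsupp F -> fsupp G -> (forall i, F i <= G i) -> fsum F <= fsum G.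
Proof.
move=> fF fG FG; have [r [ur rF rG]] := fsupp2_seq fF fG.
by rewrite !(@fsum_seq r) // ler_sum.
Qed.

Lemma fsum_ge0 F : (forall i, 0 <= F i) -> 0 <= fsum F.
Proof. by move=> F0; apply: fsumr_ge0. Qed.

Lemma eq_fsum F G : F =1 G -> fsum F = fsum G.
Proof. by move=> /funext ->. Qed.

Lemma fsum_delta i a : fsum (fun j => (j == i)%:R * a) = a.
Proof.
rewrite (@fsum_seq [:: i]) //; first by rewrite big_seq1 eqxx mul1r.
by move=> j; rewrite inE => /negPf ->; rewrite mul0r.
Qed.

Lemma fsum_sum_le F r : uniq r -> fsupp F -> (forall i, 0 <= F i) ->
  \sum_(i <- r) F i <= fsum F.
Proof.
move=> ur [s sF] F0; pose t := undup (s ++ r).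
have st i : i \notin t -> F i = 0.
  by rewrite mem_undup mem_cat negb_or => /andP[/sF].
rewrite (fsum_seq _ st) ?undup_uniq // [leRHS](bigID (mem r)) /= -[leLHS]addr0.
apply: lerD; last by apply: sumr_ge0.
rewrite -[leRHS]big_filter le_eqVlt; apply/orP; left; apply/eqP/perm_big/uniq_perm => //.
  by rewrite filter_uniq // undup_uniq.
by move=> i; rewrite mem_filter mem_undup mem_cat orbC /=; case: (i \in r).
Qed.

End FiniteSums.

Lemma fsum_exchange (R : realType) (T U : choiceType) (F : T -> U -> R) (r : seq T) (s : seq U) :
  (forall i j, i \notin r -> F i j = 0) -> (forall i j, j \notin s -> F i j = 0) ->
  fsum (fun i => fsum (F i)) = fsum (fun j => fsum (F^~ j)).
Proof.
move=> rF sF; have rF' i j : i \notin undup r -> F i j = 0 by rewrite mem_undup; exact: rF.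
have sF' i j : j \notin undup s -> F i j = 0 by rewrite mem_undup; exact: sF.
have rF2 i : i \notin undup r -> fsum (F i) = 0.
  by move=> ri; rewrite /fsum fsbig1 // => j _; exact: rF'.
have sF2 j : j \notin undup s -> fsum (F^~ j) = 0.
  by move=> sj; rewrite /fsum fsbig1 // => i _; exact: sF'.
rewrite (fsum_seq (undup_uniq r) rF2) (fsum_seq (undup_uniq s) sF2).
under eq_bigr => i _ do rewrite (fsum_seq (undup_uniq s) (sF' i)).
rewrite exchange_big /=; apply: eq_bigr => j _.
by rewrite (fsum_seq (undup_uniq r) (rF'^~ j)).
Qed.

(** * Scalar product and Jacobi operator on finitely supported sequences *)

Section IntegerSums.
Variable R : realType.
Implicit Types (F G x y : int -> R).

Lemma fsupp_shift F (a : int) : fsupp F -> fsupp (fun n => F (n + a)).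
Proof.
move=> [r rF]; exists [seq n - a | n <- r] => n nr; apply: rF.
by apply: contra nr => nr; apply/mapP; exists (n + a) => //; rewrite addrK.
Qed.

Lemma fsum_shift F (a : int) : fsum (fun n => F (n + a)) = fsum F.
Proof.
rewrite /fsum [RHS](reindex_fsbigT (fun n => n + a)) //.
by exists (fun n => n - a) => n; rewrite ?addrK ?subrK.
Qed.

Definition dotp x y : R := fsum (fun n => x n * y n).
Definition nrm2 x : R := dotp x x.

Lemma dotpC x y : dotp x y = dotp y x.
Proof. by apply: eq_fsum => n; rewrite mulrC. Qed.

Lemma dotpDl x y z : fsupp z -> dotp (fun n => x n + y n) z = dotp x z + dotp y z.
Proof.
move=> fz; rewrite /dotp -fsumD; try exact: fsuppMr.
by apply: eq_fsum => n; rewrite mulrDl.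
Qed.

Lemma dotpZl a x z : dotp (fun n => a * x n) z = a * dotp x z.
Proof. by rewrite /dotp -fsumZ; apply: eq_fsum => n; rewrite mulrA. Qed.

Lemma dotpDr x y z : fsupp z -> dotp z (fun n => x n + y n) = dotp z x + dotp z y.
Proof. by move=> fz; rewrite dotpC dotpDl // dotpC (dotpC y). Qed.

Lemma dotpZr a x z : dotp z (fun n => a * x n) = a * dotp z x.
Proof. by rewrite dotpC dotpZl dotpC. Qed.

Lemma nrm2_ge0 x : 0 <= nrm2 x.
Proof. by apply: fsum_ge0 => n; rewrite -expr2 sqr_ge0. Qed.

Lemma nrm2_sq x : nrm2 x = fsum (fun n => x n ^+ 2).
Proof. by apply: eq_fsum => n; rewrite expr2. Qed.

Lemma nrm2Z a x : nrm2 (fun n => a * x n) = a ^+ 2 * nrm2 x.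
Proof. by rewrite /nrm2 dotpZl dotpZr mulrA expr2. Qed.

Lemma nrm2_shift x (a : int) : nrm2 (fun n => x (n + a)) = nrm2 x.
Proof. by rewrite /nrm2 /dotp (fsum_shift (fun n => x n * x n)). Qed.

Lemma fsupp_sqr x : fsupp x -> fsupp (fun n => x n ^+ 2).
Proof. by move=> /fsupp_sub; apply => n ->; rewrite expr0n. Qed.

Lemma nrm2D_le x y : fsupp x -> fsupp y ->
  nrm2 (fun n => x n + y n) <= 2 * nrm2 x + 2 * nrm2 y.
Proof.
move=> fx fy; rewrite !nrm2_sq -!fsumZ -fsumD; try by apply: fsuppMr; exact: fsupp_sqr.
apply: fsum_le => [||n]; last by have := sqr_ge0 (x n - y n); nra.
  by apply/fsupp_sqr/fsuppD.
by apply: fsuppD; apply: fsuppMr; exact: fsupp_sqr.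
Qed.

Definition hop (v : int -> R) x : int -> R := fun n => x (n - 1) + x (n + 1) + v n * x n.

Lemma fsupp_hop v x : fsupp x -> fsupp (hop v x).
Proof.
move=> fx; apply: fsuppD; last exact: fsuppMr.
by apply: fsuppD; exact: fsupp_shift.
Qed.

Lemma hop_sym v x y : fsupp x -> fsupp y -> dotp (hop v x) y = dotp x (hop v y).
Proof.
move=> fx fy; rewrite /hop !dotpDl // !dotpDr //.
have -> : dotp (fun n => x (n - 1)) y = dotp x (fun n => y (n + 1)).
  rewrite /dotp -(fsum_shift (fun n => _ * _) 1); apply: eq_fsum => n.
  by rewrite addrK.
have -> : dotp (fun n => x (n + 1)) y = dotp x (fun n => y (n - 1)).
  rewrite /dotp -(fsum_shift (fun n => _ * _) (-1)); apply: eq_fsum => n.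
  by rewrite subrK.
have -> : dotp (fun n => v n * x n) y = dotp x (fun n => v n * y n).
  by apply: eq_fsum => n; ring.
by rewrite [dotp x _ + dotp x _]addrC.
Qed.

Lemma nrm2_hop_le v x (V : R) : fsupp x -> (forall n, `|v n| <= V) ->
  nrm2 (hop v x) <= (8 + 2 * V ^+ 2) * nrm2 x.
Proof.
move=> fx vV.
have fx1 a : fsupp (fun n => x (n + a)) by exact: fsupp_shift.
have := nrm2D_le (fx1 (-1)) (fx1 1); rewrite !nrm2_shift => h1.
have fvx : fsupp (fun n => v n * x n) by exact: fsuppMr.
have := nrm2D_le (fsuppD (fx1 (-1)) (fx1 1)) fvx.
rewrite -/(hop v x) => h2.
have h3 : nrm2 (fun n => v n * x n) <= V ^+ 2 * nrm2 x.
  rewrite !nrm2_sq -fsumZ; apply: fsum_le; first exact: fsupp_sqr.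
    by apply: fsuppMr; exact: fsupp_sqr.
  move=> n; rewrite exprMn ler_wpM2r ?sqr_ge0 // -real_normK ?num_real //.
  by rewrite lerXn2r // nnegrE // (le_trans _ (vV n)).
by lra.
Qed.

End IntegerSums.

(** * Quadratic forms and the distance to the spectrum *)

Section QuadraticForms.
Variables (R : realType) (v : int -> R).
Implicit Types x y : int -> R.

(** The operator [d + c h ^ 2]. It occurs as [h ^ 2 - mu] in the distance estimate and as
    [1 - h ^ 2 / b] in the Neumann series. *)
Definition qop (c d : R) x : int -> R := fun n => d * x n + c * hop v (hop v x) n.

Lemma fsupp_qop c d x : fsupp x -> fsupp (qop c d x).
Proof. by move=> fx; apply: fsuppD; apply: fsuppMr => //; do 2!apply: fsupp_hop. Qed.

Lemma dotp_qop c d x y : fsupp x -> fsupp y ->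
  dotp x (qop c d y) = d * dotp x y + c * dotp (hop v x) (hop v y).
Proof.
move=> fx fy; rewrite /qop dotpDr // !dotpZr; congr (_ + _ * _).
by rewrite -hop_sym //; exact: fsupp_hop.
Qed.

(** From [0 <= B <= q] as forms one gets [B ^ 2 <= q B]: positivity is tested on [x - B x / q], and
    the cubic term [B ^ 3] that appears is at most [q B ^ 2]. *)
Lemma nrm2_qop_le c d q : 0 < q ->
  (forall x, fsupp x -> 0 <= dotp x (qop c d x) <= q * nrm2 x) ->
  forall x, fsupp x -> nrm2 (qop c d x) <= q * dotp x (qop c d x).
Proof.
move=> q0 Bq x fx; set b := qop c d x.
have fb : fsupp b by exact: fsupp_qop.
have fBb : fsupp (qop c d b) by exact: fsupp_qop.
pose s := - q^-1.
have fy : fsupp (fun n => x n + s * b n) by apply: fsuppD => //; exact: fsuppMr.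
have By : qop c d (fun n => x n + s * b n) = (fun n => b n + s * qop c d b n).
  by apply/funext => n; rewrite /b /qop /hop; ring.
have /andP[+ _] := Bq _ fy; rewrite By => {By} h.
have xBb : dotp x (qop c d b) = nrm2 b.
  by rewrite [RHS]dotp_qop // dotp_qop // [dotp x b]dotpC [dotp (hop v x) _]dotpC.
have /andP[_ bBb] := Bq _ fb.
rewrite -/b; clearbody b; move: h.
rewrite dotpDl; last by apply: fsuppD => //; exact: fsuppMr.
rewrite dotpZl !dotpDr // !dotpZr xBb -/(nrm2 b) => h.
have h2 : s ^+ 2 * dotp b (qop c d b) <= s ^+ 2 * (q * nrm2 b).
  by rewrite ler_wpM2l ?sqr_ge0.
have : 0 <= q * (dotp x b + s * nrm2 b + s * (nrm2 b + s * dotp b (qop c d b))).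
  by rewrite mulr_ge0 // ltW.
have -> : q * (dotp x b + s * nrm2 b + s * (nrm2 b + s * dotp b (qop c d b)))
  = q * dotp x b + 2 * (q * s) * nrm2 b + q * (s ^+ 2 * dotp b (qop c d b)) by ring.
have qs : q * s = -1 by rewrite /s mulrN divff // gt_eqF.
have : q * (s ^+ 2 * dotp b (qop c d b)) <= q * (s ^+ 2 * (q * nrm2 b)).
  by rewrite ler_wpM2l // ltW.
have -> : q * (s ^+ 2 * (q * nrm2 b)) = (q * s) ^+ 2 * nrm2 b by ring.
rewrite qs; lra.
Qed.

(** Failure for every [eta > 0] is Weyl's criterion for [0] to be in the spectrum of [hop w]. *)
Definition bounded_below (w : int -> R) (eta : R) : Prop :=
  forall x, fsupp x -> eta * nrm2 x <= nrm2 (hop w x).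

End QuadraticForms.

(* If [mu] is the infimum of [|hx|^2 / |x|^2], then [h^2 - mu >= 0] is not
   bounded below, and it factors as [(h - s)(h + s)] with [s = sqrt mu]. *)
Lemma near_spectrum (R : realType) (v : int -> R) (V e : R) (chi : int -> R) :
  (forall n, `|v n| <= V) -> 0 <= e -> fsupp chi -> 0 < nrm2 chi ->
  nrm2 (hop v chi) <= e ^+ 2 * nrm2 chi ->
  exists2 s : R, `|s| <= e & forall eta, 0 < eta -> ~ bounded_below (fun n => v n - s) eta.
Proof.
move=> vV e0 fchi chi0 hchi.
pose S := [set t | exists2 x, fsupp x & 0 < nrm2 x /\ t = nrm2 (hop v x) / nrm2 x].
have S0 t : S t -> 0 <= t by move=> [x _ [x0 ->]]; rewrite divr_ge0 ?nrm2_ge0.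
have Schi : S (nrm2 (hop v chi) / nrm2 chi) by exists chi.
have infS : has_inf S by split; [exists (nrm2 (hop v chi) / nrm2 chi) | exists 0 => t /S0].
pose mu := inf S.
have mu0 : 0 <= mu by apply: lb_le_inf; [exists (nrm2 (hop v chi) / nrm2 chi) | move=> t /S0].
have mue : mu <= e ^+ 2.
  by apply: le_trans (ge_inf infS.2 Schi) _; rewrite ler_pdivrMr.
have muP x : fsupp x -> mu * nrm2 x <= nrm2 (hop v x).
  move=> fx; have := nrm2_ge0 x; rewrite le_eqVlt => /orP[/eqP <-|x0].
    by rewrite mulr0 nrm2_ge0.
  by rewrite -ler_pdivlMr //; apply: (ge_inf infS.2); exists x.
pose s := Num.sqrt mu.
have s2 : s ^+ 2 = mu by rewrite sqr_sqrtr.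
have se : `|s| <= e.
  by rewrite ger0_norm ?sqrtr_ge0 // -(ler_pXn2r (n := 2)) ?nnegrE ?sqrtr_ge0 // s2.
case: (pselect (forall eta, 0 < eta -> ~ bounded_below (fun n => v n - s) eta)) => [h|].
  by exists s.
move=> /existsNP[e1 /not_implyP[e1_gt0 /contrapT b1]].
exists (- s); first by rewrite normrN.
move=> e2 e2_gt0 b2.
pose q := 8 + 2 * V ^+ 2.
have q0 : 0 < q by rewrite /q; have := sqr_ge0 V; lra.
have Bq x : fsupp x -> 0 <= dotp x (qop v 1 (- mu) x) <= q * nrm2 x.
  move=> fx; rewrite dotp_qop // -!/(nrm2 _) mul1r mulNr.
  have := muP _ fx; have := nrm2_hop_le fx vV; have := nrm2_ge0 x.
  rewrite -/q => ? ? ?; apply/andP; split; first lra.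
  by have := mulr_ge0 mu0 (nrm2_ge0 x); lra.
(* The two lower bounds multiply to one for [|(h ^ 2 - mu) x| ^ 2]; [nrm2_qop_le] converts it into a
   gap for the form [h ^ 2 - mu], against the choice of [mu]. *)
have low x : fsupp x -> 0 < nrm2 x -> mu + e1 * e2 / q <= nrm2 (hop v x) / nrm2 x.
  move=> fx x0.
  have h1 := b2 _ fx; have h2 := b1 _ (fsupp_hop (fun n => v n - - s) fx).
  have E : hop (fun n => v n - s) (hop (fun n => v n - - s) x) = qop v 1 (- mu) x.
    by apply/funext => n; rewrite /qop /hop -s2; ring.
  rewrite E in h2.
  have h3 := nrm2_qop_le q0 Bq fx; rewrite dotp_qop // -!/(nrm2 _) mul1r mulNr in h3.
  have h4 : e1 * e2 * nrm2 x <= q * (- (mu * nrm2 x) + nrm2 (hop v x)).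
    apply: le_trans (le_trans h2 h3); rewrite -mulrA ler_wpM2l // ltW //.
  rewrite ler_pdivlMr // mulrDl -lerBrDl mulrAC ler_pdivrMr //.
  by rewrite [_ * q]mulrC addrC.
have : mu + e1 * e2 / q <= mu.
  apply: lb_le_inf; first by exists (nrm2 (hop v chi) / nrm2 chi).
  by move=> t [x fx [x0 ->]]; exact: low.
by rewrite gerDl leNgt divr_gt0 // mulr_gt0.
Qed.

(** * Square summable sequences and inversion of the operator *)

Section SquareSummable.
Variable R : realType.
Implicit Types x y : int -> R.

(** A real-valued form of [sqnorm x <= c], so that extended reals occur only at the interface with
    [resolvent]. *)
Definition l2bound x (c : R) : Prop :=
  forall r : seq int, uniq r -> \sum_(n <- r) x n ^+ 2 <= c.

Lemma l2bound_ge0 x c : l2bound x c -> 0 <= c.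
Proof. by move=> /(_ [::] isT); rewrite big_nil. Qed.

Lemma sqnorm_leP x c : 0 <= c -> (sqnorm x <= c%:E)%E <-> l2bound x c.
Proof.
move=> c0; split=> [h r ur|h].
  rewrite -lee_fin; apply: le_trans h; rewrite /sqnorm; apply: esum_ge.
  exists [set` r]; first by split=> //; exact: finite_seq.
  by rewrite -fsbig_seq // -sumEFin.
apply: ge_ereal_sup => _ [A [finA _] <-].
by rewrite fsbig_finite //= sumEFin lee_fin; apply: h; exact: finmap.fset_uniq.
Qed.

Lemma sqnorm_ge0 x : (0 <= sqnorm x)%E.
Proof. by apply: esum_ge0 => n _; rewrite lee_fin sqr_ge0. Qed.

Lemma l2_bound x : l2 x -> exists c, l2bound x c /\ sqnorm x = c%:E.
Proof.
rewrite /l2 => h; exists (fine (sqnorm x)).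
have e : sqnorm x = (fine (sqnorm x))%:E.
  by rewrite fineK // ge0_fin_numE // sqnorm_ge0.
split=> //; apply/sqnorm_leP; last by rewrite -e.
by apply: fine_ge0; exact: sqnorm_ge0.
Qed.

Lemma l2bound_l2 x c : l2bound x c -> l2 x.
Proof.
move=> h; have c0 := l2bound_ge0 h.
by rewrite /l2 (le_lt_trans (proj2 (sqnorm_leP x c0) h)) // ltry.
Qed.

Lemma nrm2_bound x : fsupp x -> l2bound x (nrm2 x).
Proof.
move=> fx r ur; rewrite nrm2_sq; apply: fsum_sum_le => // [|n]; last exact: sqr_ge0.
exact: fsupp_sqr.
Qed.

Lemma sqnorm_fsupp x : fsupp x -> sqnorm x = (nrm2 x)%:E.
Proof.
move=> fx; apply/eqP; rewrite eq_le; apply/andP; split.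
  by apply/sqnorm_leP; [exact: nrm2_ge0 | exact: nrm2_bound].
have [r rx] := fsupp_sqr fx.
have rx' i : i \notin undup r -> x i ^+ 2 = 0 by rewrite mem_undup; exact: rx.
rewrite nrm2_sq (fsum_seq _ rx') ?undup_uniq //; apply: esum_ge.
exists [set` undup r]; first by split=> //; exact: finite_seq.
by rewrite -fsbig_seq ?undup_uniq // -sumEFin.
Qed.

Definition local (A : (int -> R) -> int -> R) : Prop :=
  forall n, exists s : seq int, forall x y, {in s, x =1 y} -> A x n = A y n.

(** A finite partial sum of [A x] sees only finitely many coordinates of [x], so [x] may be
    truncated and the bound for finitely supported vectors applies. *)
Lemma l2bound_local A K : 0 <= K -> local A ->
  (forall x, fsupp x -> fsupp (A x) /\ nrm2 (A x) <= K * nrm2 x) ->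
  forall x c, l2bound x c -> l2bound (A x) (K * c).
Proof.
move=> K0 /choice[s sP] AK x c xc r ur.
pose t := undup (flatten [seq s n | n <- r]).
pose y n := (n \in t)%:R * x n.
have ty i : i \notin t -> y i = 0 by rewrite /y => /negPf ->; rewrite mul0r.
have fy : fsupp y by exists t.
have xy n : n \in r -> A x n = A y n.
  move=> nr; apply: sP => m ms; rewrite /y (_ : m \in t) ?mul1r //.
  by rewrite mem_undup; apply/flattenP; exists (s n) => //; apply/mapP; exists n.
rewrite (@eq_big_seq _ _ _ _ _ _ (fun n => A y n ^+ 2)) => [|n /xy -> //].
have [fAy Ay] := AK _ fy.
apply: le_trans (nrm2_bound fAy ur) _; apply: le_trans Ay _.
rewrite ler_wpM2l // nrm2_sq (@fsum_seq _ _ t) ?undup_uniq //; last first.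
  by move=> i /ty ->; rewrite expr0n.
apply: le_trans (xc t (undup_uniq _)); apply: ler_sum => n _.
rewrite /y; case: (n \in t); first by rewrite mul1r.
by rewrite mul0r expr0n sqr_ge0.
Qed.

(** Stands in for the triangle inequality. The weights are such that [c / (1 - q) ^ 2] is reproduced
    by the recursion [S x N.+1 = x + B (S x N)] when [B] contracts squared norms by [q ^ 2]. *)
Lemma l2bound_convex x y q c d : 0 < q < 1 -> l2bound x c -> l2bound y d ->
  l2bound (fun n => x n + y n) (c / (1 - q) + d / q).
Proof.
move=> /andP[q0 q1] xc yd r ur.
have q1' : 0 < 1 - q by rewrite subr_gt0.
apply: le_trans (_ : \sum_(n <- r) (x n ^+ 2 / (1 - q) + y n ^+ 2 / q) <= _).
  apply: ler_sum => n _; rewrite -subr_ge0.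
  have -> : x n ^+ 2 / (1 - q) + y n ^+ 2 / q - (x n + y n) ^+ 2 =
     (q * x n - (1 - q) * y n) ^+ 2 / (q * (1 - q)).
    by field; rewrite !gt_eqF.
  by rewrite divr_ge0 ?sqr_ge0 // mulr_ge0 // ltW.
rewrite big_split /= -!mulr_suml; apply: lerD.
  by rewrite ler_pM2r ?invr_gt0 // xc.
by rewrite ler_pM2r ?invr_gt0 // yd.
Qed.

Lemma l2bound_lim (x : nat -> int -> R) y c :
  (forall n, x k n @[k --> \oo] --> y n) -> (forall k, l2bound (x k) c) -> l2bound y c.
Proof.
move=> xy xc r ur.
have cv : (\sum_(n <- r) x k n ^+ 2) @[k --> \oo] --> \sum_(n <- r) y n ^+ 2.
  have -> : (fun k => \sum_(n <- r) x k n ^+ 2) = \sum_(n <- r) (fun k => x k n ^+ 2).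
    by apply/funext => k; rewrite fct_sumE.
  elim: r {ur} => [|n r IH]; first by rewrite !big_nil; exact: cvg_cst.
  rewrite !big_cons; apply: cvgD => //.
  by under eq_fun do rewrite expr2; rewrite expr2; apply: cvgM.
rewrite -(cvg_lim _ cv) //; apply: limr_le; first by apply/cvg_ex; eexists; exact: cv.
by apply: nearW => k; exact: xc.
Qed.

End SquareSummable.

(* With [h = hop v], the inverse of [h ^ 2] is the Neumann series of
   [B = 1 - h ^ 2 / b], a contraction, and [h (h ^ 2)^-1] inverts [h]. *)
Section Resolvent.
Variables (R : realType) (v : int -> R) (V eta : R).
Hypothesis vV : forall n, `|v n| <= V.
Hypothesis eta0 : 0 < eta.
Hypothesis low : bounded_below v eta.
Implicit Types x y : int -> R.

Let K := 8 + 2 * V ^+ 2.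
Let K0 : 0 < K. Proof. by rewrite /K; have := sqr_ge0 V; lra. Qed.
(** As [eta <= h ^ 2 <= K <= b], the form of [B] lies between [0] and [q]; [K > 0] makes [q]
    positive. *)
Let b := K + eta.
Let b0 : 0 < b. Proof. exact: addr_gt0. Qed.
Let q := 1 - eta / b.
Let q01 : 0 < q < 1.
Proof.
apply/andP; split; last by rewrite /q ltrBlDr ltrDl divr_gt0.
by rewrite /q subr_gt0 ltr_pdivrMr // mul1r /b ltrDr.
Qed.
Let q0 : 0 < q. Proof. by case/andP: q01. Qed.
Let q1 : q < 1. Proof. by case/andP: q01. Qed.
Let B := qop v (- b^-1) 1.

Let hop_local : local (hop v).
Proof.
move=> n; exists [:: n - 1; n; n + 1] => x y xy.
by rewrite /hop !xy // !inE eqxx ?orbT.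
Qed.

Let B_local : local B.
Proof.
move=> n; exists [:: n - 1 - 1; n - 1; n - 1 + 1; n + 1 - 1; n; n + 1; n + 1 + 1] => x y xy.
by rewrite /B /qop /hop !xy // !inE eqxx ?orbT.
Qed.

Let B_contr x : fsupp x -> fsupp (B x) /\ nrm2 (B x) <= q ^+ 2 * nrm2 x.
Proof.
have Bq y : fsupp y -> 0 <= dotp y (B y) <= q * nrm2 y.
  move=> fy; rewrite dotp_qop // -!/(nrm2 _) mul1r mulNr.
  have h1 := low fy; have h2 := nrm2_hop_le fy vV.
  apply/andP; split.
    rewrite subr_ge0 mulrC ler_pdivrMr // (le_trans h2) // mulrC ler_wpM2l ?nrm2_ge0 //.
    by rewrite /b lerDl ltW.
  by rewrite /q mulrBl mul1r lerD2l lerN2 mulrAC mulrC ler_pM2l ?invr_gt0.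
move=> fx; split; first exact: fsupp_qop.
apply: le_trans (nrm2_qop_le q0 Bq fx) _.
by rewrite expr2 -mulrA ler_pM2l //; case/andP: (Bq _ fx).
Qed.

Let Bbound x c : l2bound x c -> l2bound (B x) (q ^+ 2 * c).
Proof. exact: (l2bound_local (sqr_ge0 q) B_local B_contr). Qed.

Let hop_bound x c : l2bound x c -> l2bound (hop v x) (K * c).
Proof.
apply: l2bound_local => //; first exact: ltW.
by move=> y fy; split; [exact: fsupp_hop | exact: nrm2_hop_le].
Qed.

Let S x : nat -> int -> R := fun N n => series (fun k => iter k B x n) N.

Let S_succ x N n : S x N.+1 n = x n + B (S x N) n.
Proof.
have BD y z : B (fun n => y n + z n) = (fun n => B y n + B z n).
  by apply/funext => m; rewrite /B /qop /hop; ring.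
elim: N n => [|N IH] n.
  by rewrite /B /qop /hop /S /series /= big_nat1 !big_geq // !(mulr0, addr0).
have SS M : S x M.+1 = (fun m => S x M m + iter M B x m).
  by apply/funext => m; rewrite /S /series /= big_nat_recr.
have -> : S x N.+2 n = S x N.+1 n + iter N.+1 B x n by rewrite SS.
by rewrite IH -addrA (SS N) BD.
Qed.

Let S_bound x c N : l2bound x c -> l2bound (S x N) (c / (1 - q) ^+ 2).
Proof.
move=> xc; elim: N => [|N IH].
  move=> r _; rewrite big1 => [|n _]; last by rewrite /S /series /= big_geq // expr0n.
  by rewrite divr_ge0 ?sqr_ge0 // (l2bound_ge0 xc).
have -> : S x N.+1 = (fun n => x n + B (S x N) n) by apply/funext => n; exact: S_succ.
have := l2bound_convex q01 xc (Bbound IH).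
congr (l2bound _ _); field.
by rewrite (gt_eqF q0) subr_eq0 gt_eqF.
Qed.

Let S_cvg x c n : l2bound x c -> cvgn (S x ^~ n).
Proof.
move=> xc; apply: normed_cvg.
have it k : l2bound (iter k B x) ((q ^+ k) ^+ 2 * c).
  elim: k => [|k IH]; first by rewrite expr0 expr1n mul1r.
  have := Bbound IH; rewrite /= mulrA; congr (l2bound _ (_ * _)).
  by rewrite -exprMn -exprS.
apply: (@series_le_cvg _ _ (fun k => geometric (Num.sqrt c) q k)) => [k|k|k|].
- exact: normr_ge0.
- by rewrite /= mulr_ge0 ?sqrtr_ge0 // exprn_ge0 // ltW.
- rewrite /= -(ler_pXn2r (n := 2)) ?nnegrE ?mulr_ge0 ?sqrtr_ge0 ?exprn_ge0 ?(ltW q0) //.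
  rewrite real_normK ?num_real // exprMn sqr_sqrtr ?(l2bound_ge0 xc) // mulrC.
  by have := it k [:: n] isT; rewrite big_seq1.
- by apply: is_cvg_geometric_series; rewrite gtr0_norm.
Qed.

Let G0 x n := limn (S x ^~ n).

Let hop_lim (X : nat -> int -> R) y n : (forall m, X k m @[k --> \oo] --> y m) ->
  hop v (X k) n @[k --> \oo] --> hop v y n.
Proof.
move=> Xy; rewrite /hop; apply: cvgD; first exact: cvgD.
by apply: cvgM => //; exact: cvg_cst.
Qed.

Let G0_lim x c : l2bound x c -> forall n, S x k n @[k --> \oo] --> G0 x n.
Proof. by move=> xc n; apply: S_cvg xc. Qed.

Let hop_G0 x c : l2bound x c -> G0 (hop v x) = hop v (G0 x).
Proof.
move=> xc; apply/funext => n; apply: cvg_lim => //.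
have -> : S (hop v x) ^~ n = (fun k => hop v (S x k) n).
  apply/funext => k; elim: k n => [|k IH] n.
    by rewrite /hop /S /series /= !big_geq // mulr0 !addr0.
  rewrite S_succ /hop !S_succ /B /qop /hop !IH.
  by rewrite /hop; ring.
by apply: hop_lim; exact: G0_lim xc.
Qed.

Let G0_inv x c : l2bound x c -> hop v (hop v (G0 x)) = (fun n => b * x n).
Proof.
move=> xc; apply/funext => n.
have h1 : S x k.+1 n @[k --> \oo] --> G0 x n.
  by have := @G0_lim _ _ xc n; rewrite -cvg_shiftS.
have h2 : S x k.+1 n @[k --> \oo] --> x n + B (G0 x) n.
  under eq_fun do rewrite S_succ; apply: cvgD; first exact: cvg_cst.
  apply: cvgD; first by apply: cvgM; [exact: cvg_cst | exact: G0_lim xc n].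
  by apply: cvgM; [exact: cvg_cst|]; apply: hop_lim => m; apply: hop_lim; exact: G0_lim xc.
have : G0 x n = x n + B (G0 x) n.
  by rewrite -[LHS](cvg_lim _ h1) // (cvg_lim _ h2).
rewrite /B /qop mul1r => e; have : b * (x n + - b^-1 * hop v (hop v (G0 x)) n) = 0.
  by rewrite [X in _ * X](_ : _ = 0) ?mulr0 //; lra.
rewrite mulrDr mulrA mulrN divff ?gt_eqF // mulN1r => /eqP.
by rewrite subr_eq0 => /eqP.
Qed.

Lemma bounded_below_inverse : exists G : (int -> R) -> (int -> R), exists C : R,
  forall x, l2 x -> [/\ l2 (G x), hop v (G x) = x, G (hop v x) = x &
    (sqnorm (G x) <= (C ^+ 2)%:E * sqnorm x)%E].
Proof.
pose G x := fun n => b^-1 * hop v (G0 x) n.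
pose D := b^-1 ^+ 2 * (K * (1 - q)^-1 ^+ 2).
have D0 : 0 <= D by rewrite /D mulr_ge0 ?sqr_ge0 // mulr_ge0 ?sqr_ge0 // ltW.
exists G, (Num.sqrt D) => x /l2_bound[c [xc ->]].
have Gx : l2bound (G x) (D * c).
  have := hop_bound (l2bound_lim (G0_lim xc) (fun k => S_bound k xc)).
  move=> h r ur; rewrite /G; under eq_bigr do rewrite exprMn.
  rewrite -mulr_sumr /D -[leRHS]mulrA ler_wpM2l ?sqr_ge0 //.
  by apply: le_trans (h r ur) _; rewrite exprVn -[leRHS]mulrA [_ * c]mulrC.
have hopbG y : hop v (fun n => b^-1 * y n) = (fun n => b^-1 * hop v y n).
  by apply/funext => n; rewrite /hop; ring.
split.
- exact: l2bound_l2 Gx.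
- rewrite hopbG (G0_inv xc); apply/funext => n.
  by rewrite mulrA mulVf ?mul1r // gt_eqF.
- rewrite /G (hop_G0 xc) (G0_inv xc); apply/funext => n.
  by rewrite mulrA mulVf ?mul1r // gt_eqF.
- rewrite sqr_sqrtr // -EFinM; apply/sqnorm_leP => //.
  by rewrite mulr_ge0 // (l2bound_ge0 xc).
Qed.

End Resolvent.

(** * The spectrum as failure of a lower bound *)

Section Spectrum.
Variables (R : realType) (f : R -> R) (alpha theta : R).

Definition pot (E : R) : int -> R := fun n => f (alpha * n%:~R + theta) - E.

Lemma Hop_pot E psi : (fun n => Hop f alpha theta psi n - E * psi n) = hop (pot E) psi.
Proof. by apply/funext => n; rewrite /Hop /hop /pot; ring. Qed.

Lemma resolvent_bounded_below E : resolvent f alpha theta E ->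
  exists2 eta, 0 < eta & bounded_below (pot E) eta.
Proof.
(* The summand [1] covers the case [C = 0]. *)
move=> [G [C GP]]; have C1 : 0 < C ^+ 2 + 1 by have := sqr_ge0 C; lra.
exists (C ^+ 2 + 1)^-1; first by rewrite invr_gt0.
move=> x fx; rewrite mulrC ler_pdivrMr //.
have fh : fsupp (hop (pot E) x) by exact: fsupp_hop.
have [_ _ e1 _] := GP _ (l2bound_l2 (nrm2_bound fx)).
have [_ _ _] := GP _ (l2bound_l2 (nrm2_bound fh)).
rewrite Hop_pot in e1; rewrite e1 !sqnorm_fsupp // -EFinM lee_fin.
by have := nrm2_ge0 (hop (pot E) x); lra.
Qed.

Lemma bounded_below_resolvent (M : R) E eta : (forall x, `|f x| <= M) -> 0 < eta ->
  bounded_below (pot E) eta -> resolvent f alpha theta E.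
Proof.
move=> fM eta0 low.
have vV n : `|pot E n| <= M + `|E|.
  by apply: le_trans (ler_normB _ _) _; rewrite lerD2r.
have [G [C GP]] := bounded_below_inverse vV eta0 low.
exists G, C => psi /GP[? ? ? ?]; split=> //; first by rewrite Hop_pot.
by rewrite Hop_pot.
Qed.

End Spectrum.

(** * Continued fractions and uniform density of orbits *)

Section Density.
Variable R : realType.
Implicit Types (alpha : R) (M : int).

(* [p / q] and [p' / q'] are consecutive convergents of [alpha], the former of
   index [k], and [gauss_iter alpha k] is the corresponding remainder. *)
Definition convergent alpha (k : nat) (p q p' q' : int) : Prop :=
  [/\ `|p * q' - p' * q| = 1, 0 <= q' <= q, 0 < q &
      alpha * (q%:~R + q'%:~R * gauss_iter alpha k) = p%:~R + p'%:~R * gauss_iter alpha k].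

Lemma fracpart_itv (x : R) : 0 <= fracpart x < 1.
Proof. by rewrite /fracpart subr_ge0 floor_le ltrBlDl -intrD1 floorD1_gt. Qed.

Lemma gauss_iter_itv alpha k : 0 <= gauss_iter alpha k < 1.
Proof. by case: k => [|k]; exact: fracpart_itv. Qed.

Lemma gauss_iter_gt0 alpha k p q p' q' : Defs.irrational alpha ->
  convergent alpha k p q p' q' -> 0 < gauss_iter alpha k.
Proof.
move=> irr [_ _ q0 e]; have /andP[+ _] := gauss_iter_itv alpha k.
rewrite le_eqVlt => /orP[/eqP x0|//]; move: e; rewrite -x0 !mulr0 !addr0 => e.
have := irr (p%:Q / q%:Q); rewrite (_ : ratr _ = p%:~R / q%:~R) => [/eqP[]|]; last first.
  by rewrite fmorph_div /= !rmorph_int.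
by rewrite -e mulfK // intr_eq0 gt_eqF.
Qed.

(** The usual recurrence with partial quotient [a = cf_coef alpha k]. The bound [a <= M] limits the
    jump of the denominator, and [a >= 1] makes it grow. *)
Lemma convergent_next alpha M k p q p' q' : Defs.irrational alpha ->
  (forall k, cf_coef alpha k <= M) -> convergent alpha k p q p' q' ->
  exists p1 q1, [/\ convergent alpha k.+1 p1 q1 p q, q1 <= (M + 1) * q & q + q' <= q1].
Proof.
move=> irr aM c; have x0 := gauss_iter_gt0 irr c.
have /andP[_ x1] := gauss_iter_itv alpha k.
case: c => [det /andP[q'0 q'q] q0 e].
pose a := cf_coef alpha k.
have a1 : 1 <= a by rewrite floor_ge_int div1r invf_ge1 // ltW.
have ax : (gauss_iter alpha k)^-1 = a%:~R + gauss_iter alpha k.+1.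
  by rewrite /= /fracpart -/(cf_coef alpha k) -/a div1r addrC subrK.
exists (a * p + p'), (a * q + q'); split.
- have a0 := lt_le_trans ltr01 a1; split; [|nia|nia|].
    by rewrite -[RHS]det -[RHS]normrN; congr `|_|; ring.
  apply: (mulIf (lt0r_neq0 x0)).
  have xx : gauss_iter alpha k.+1 * gauss_iter alpha k = 1 - a%:~R * gauss_iter alpha k.
    by apply/eqP; rewrite eq_sym subr_eq -mulrDl [_ + a%:~R]addrC -ax mulVf // gt_eqF.
  rewrite -mulrA !mulrDl -!mulrA xx !intrD !intrM.
  have -> : alpha * ((a%:~R * q%:~R + q'%:~R) * gauss_iter alpha k +
     q%:~R * (1 - a%:~R * gauss_iter alpha k)) =
     alpha * (q%:~R + q'%:~R * gauss_iter alpha k) by ring.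
  by rewrite e; ring.
- by have := aM k; rewrite -/a; nia.
- by nia.
Qed.

(** The sum [q + q'] increases at every step, so denominators eventually reach [N]. The first one to
    do so is at most [M + 1] times its predecessor, which is below [N]. *)
Lemma convergent_scale alpha : Omega alpha -> exists2 M : int, 0 <= M &
  forall N : int, 1 < N -> exists k p q p' q',
    convergent alpha k p q p' q' /\ N <= q <= (M + 1) * N.
Proof.
move=> [irr [M aM]].
have M0 : 0 <= M.
  apply: le_trans (aM 0%N); rewrite floor_ge0 div1r invr_ge0.
  by case/andP: (gauss_iter_itv alpha 0).
exists M => // N N1.
have step n : (exists k p q p' q', convergent alpha k p q p' q' /\ N <= q <= (M + 1) * N) \/
   (exists k p q p' q', [/\ convergent alpha k p q p' q', q < N & n%:Z <= q + q']).
  elim: n => [|n [IH|[k [p [q [p' [q' [c qN nq]]]]]]]]; [right|by left|].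
    exists 0%N, (Num.floor alpha), 1, 1, 0; split=> //; split=> //.
      by rewrite mulr0 mulr1 sub0r normrN.
    by rewrite mul0r addr0 mulr1 mul1r /= /fracpart addrC subrK.
  have [p1 [q1 [c1 q1M q1q]]] := convergent_next irr aM c.
  case: c => _ ? ? _.
  have [q1N|q1N] := ltP q1 N; [right|left].
    by exists k.+1, p1, q1, p, q; split=> //; lia.
  exists k.+1, p1, q1, p, q; split=> //; apply/andP; split=> //.
  by apply: le_trans q1M _; apply: ler_wpM2l; lia.
have [//|[k [p [q [p' [q' [[_ ? _ _] qN nq]]]]]]] := step (`|N| + `|N|)%N.
by exfalso; lia.
Qed.

(** For a convergent [p / q], the multiples [x * alpha] with [x < q] stay within [1 / q] of
    [x * p / q], and [x * p] runs over all residues modulo [q]. Thus any [q] consecutive orbit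
    points meet every interval of length [4 / q] modulo [1]. *)
Lemma orbit_density alpha : Omega alpha -> exists C : nat, forall Q : nat, (0 < Q)%N ->
  exists2 q : nat, (q <= C * Q)%N & forall (j : int) (i : nat),
    exists2 x : nat, (x < q)%N & exists z : int,
      i%:R / Q%:R <= (j + x%:Z)%:~R * alpha - z%:~R < i.+1%:R / Q%:R.
Proof.
move=> Om; have [M M0 scale] := convergent_scale Om.
exists ((`|M| + 1) * 4)%N => Q Q0.
have [|k [p [q [p' [q' [c /andP[Nq qN]]]]]]] := scale (4 * Q%:Z); first by lia.
have x0 := gauss_iter_gt0 Om.1 c; have /andP[_ x1] := gauss_iter_itv alpha k.
case: c => [det /andP[q'0 q'q] q0 e].
exists `|q|%N; first by nia.
set y := gauss_iter alpha k in e x0 x1.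
move=> j i.
have qr0 : 0 < q%:~R :> R by rewrite ltr0z.
have Qr0 : 0 < Q%:R :> R by rewrite ltr0n.
have dist : `|alpha * q%:~R - p%:~R| <= q%:~R^-1.
  have q'r : 0 <= q'%:~R :> R by rewrite ler0z.
  have d0 : 0 < q%:~R + q'%:~R * y by rewrite ltr_wpDr // mulr_ge0 // ltW.
  have -> : alpha * q%:~R - p%:~R = - (y * (p * q' - p' * q)%:~R / (q%:~R + q'%:~R * y)).
    apply: (mulIf (lt0r_neq0 d0)); rewrite mulNr divfK ?gt_eqF // mulrBl mulrAC.
    by rewrite e intrB !intrM; ring.
  rewrite normrN normrM normfV normrM -intr_norm det mulr1 (gtr0_norm x0) (gtr0_norm d0).
  rewrite ler_pdivrMr // mulrC ler_pdivlMr // ler_wpDr ?mulr_ge0 // 1?ltW //.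
  by rewrite -[ltRHS]mul1r ltr_pM2r.
(* The neighbouring convergent supplies the inverse [s] of [p] modulo [q]. *)
have [s [u su]] : exists s u : int, p * s - q * u = 1.
  have := det; have [_|_] := ger0P (p * q' - p' * q) => e1.
    by exists q', p'; rewrite -e1; ring.
  by exists (- q'), (- p'); rewrite -e1; ring.
(* The target is moved right by [1 / q] to leave room for an error of [1 / q] to the left. With the
   rounding and the error to the right the point stays within [3 / q] of the left end, which is less
   than [1 / Q] because [q >= 4 Q]. *)
pose g := (i%:R / Q%:R + q%:~R^-1 - j%:~R * alpha) * q%:~R.
pose t := Num.ceil g.
exists `|(t * s %% q)%Z|%N; first by have := ltz_pmod (t * s) q0; have := modz_ge0 (t * s) (lt0r_neq0 q0); lia.
set x := (t * s %% q)%Z.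
have x_ge0 : 0 <= x by apply: modz_ge0; exact: lt0r_neq0.
have x_lt : x < q by exact: ltz_pmod.
have xabs : (`|x|%N)%:Z = x by rewrite gez0_abs.
pose m := (t * s %/ q)%Z.
have xe : x = t * s - m * q by rewrite (divz_eq (t * s) q) /m /x addrC addKr.
exists (t * u - m * p).
have key : (x * p - (t * u - m * p) * q) = t.
  by rewrite xe -[RHS]mulr1 -su; ring.
rewrite xabs.
have -> : (j + x)%:~R * alpha - (t * u - m * p)%:~R =
   j%:~R * alpha + t%:~R / q%:~R + (x%:~R / q%:~R) * (alpha * q%:~R - p%:~R).
  rewrite -[t in t%:~R / _]key !(intrB, intrD, intrM); field.
  by rewrite gt_eqF.
have xq : 0 <= (x%:~R / q%:~R : R) <= 1.
  by rewrite divr_ge0 ?ler0z ?(ltW q0) //= ler_pdivrMr // mul1r ler_int ltW.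
have err : `|(x%:~R / q%:~R) * (alpha * q%:~R - p%:~R)| <= q%:~R^-1.
  case/andP: xq => a1 a2; rewrite normrM (ger0_norm a1) -[leRHS]mul1r.
  by apply: ler_pM.
have /andP[t1 t2] := ceil_itv g.
have T1 : i%:R / Q%:R + q%:~R^-1 - j%:~R * alpha <= t%:~R / q%:~R.
  by rewrite ler_pdivlMr.
have T2 : t%:~R / q%:~R < i%:R / Q%:R + q%:~R^-1 - j%:~R * alpha + q%:~R^-1.
  rewrite ltr_pdivrMr // [ltRHS]mulrDl mulVf ?gt_eqF // -ltrBlDr.
  by rewrite intrB in t1.
have q4 : 4 * q%:~R^-1 <= Q%:R^-1 :> R.
  rewrite ler_pdivrMr // mulrC ler_pdivlMr //.
  by rewrite -[Q%:R]/((Q%:Z)%:~R) -[4]/(4%:~R) -intrM ler_int.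
have iQ : i.+1%:R / Q%:R = i%:R / Q%:R + Q%:R^-1 :> R by rewrite -natr1 mulrDl mul1r.
have qi : 0 < q%:~R^-1 :> R by rewrite invr_gt0.
by move: err; rewrite ler_norml iQ => /andP[? ?]; apply/andP; split; lra.
Qed.

End Density.

(** * Polynomial approximation of periodic analytic functions *)

Section PowerSeries.
Variable R : realType.

(** The mean value bound with slope [k t ^ (k - 1)], multiplied by [t] to avoid the exponent
    [k - 1]. *)
Lemma exprB_le (t u w : R) k : `|u| <= t -> `|w| <= t ->
  `|u ^+ k - w ^+ k| * t <= k%:R * t ^+ k * `|u - w|.
Proof.
move=> ut wt; have t0 := le_trans (normr_ge0 _) ut.
elim: k => [|k IH]; first by rewrite !expr0 subrr normr0 !mul0r.
have -> : u ^+ k.+1 - w ^+ k.+1 = u * (u ^+ k - w ^+ k) + (u - w) * w ^+ k.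
  by rewrite !exprS; ring.
apply: le_trans (_ : (t * `|u ^+ k - w ^+ k| + `|u - w| * t ^+ k) * t <= _).
  rewrite ler_wpM2r // (le_trans (ler_normD _ _)) // !normrM normrX; apply: lerD.
    by rewrite ler_wpM2r.
  by rewrite ler_wpM2l // lerXn2r.
rewrite mulrDl -mulrA; have := ler_wpM2l t0 IH.
by rewrite -natr1 exprS; nra.
Qed.

Lemma sum_half_powers (d n : nat) :
  \sum_(d <= k < d + n) (2^-1 : R) ^+ k <= 2 * 2^-1 ^+ d.
Proof.
suff -> : \sum_(d <= k < d + n) (2^-1 : R) ^+ k = 2 * 2^-1 ^+ d - 2 * 2^-1 ^+ (d + n).
  by rewrite gerBl mulr_ge0 // exprn_ge0.
elim: n => [|n IH]; first by rewrite addn0 big_geq // subrr.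
by rewrite addnS big_nat_recr ?leq_addr //= IH exprS; field.
Qed.

Lemma sum_index_half_powers (n : nat) : \sum_(0 <= k < n) k%:R * (2^-1 : R) ^+ k <= 2.
Proof.
suff -> : \sum_(0 <= k < n) k%:R * (2^-1 : R) ^+ k = 2 - 2 * n.+1%:R * 2^-1 ^+ n.
  by rewrite gerBl !mulr_ge0 // exprn_ge0.
elim: n => [|n IH]; first by rewrite big_geq // expr0; lra.
by rewrite big_nat_recr //= IH exprS -!natr1; field.
Qed.

(** The single [M] is inverse radius, error factor and Lipschitz constant at once. The property
    weakens as [M] grows, which suits a compactness argument. *)
Definition poly_approx (f : R -> R) (M x : R) : Prop :=
  (forall d : nat, exists2 p : {poly R}, (size p <= d)%N &
     forall y, `|y - x| < M^-1 -> `|f y - p.[y]| <= M * 2^-1 ^+ d) /\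
  (forall y, `|y - x| < M^-1 -> `|f x - f y| <= M * `|x - y|).

Lemma analytic_poly_approx (f : R -> R) (x0 : R) : real_analytic f ->
  exists2 M0 : R, 0 < M0 & forall M x, M0 <= M -> `|x - x0| < M0^-1 -> poly_approx f M x.
Proof.
move=> /(_ x0)[r r0 [a ax]].
pose s := r / 2; have s0 : 0 < s by rewrite divr_gt0.
(* Convergence at the one point [x0 + s] bounds [a k * s ^ k]; halving the radius then yields the
   decay [2 ^- k]. *)
have [C C0 aC] : exists2 C, 0 < C & forall k, `|a k| * s ^+ k <= C.
  have cs : series (fun k => a k * s ^+ k) @ \oo --> f (x0 + s).
    have := ax (x0 + s); rewrite [x0 + s]addrC addrK; apply.
    by rewrite gtr0_norm // /s; lra.
  have /cvg_series_cvg_0 : cvgn (series (fun k => a k * s ^+ k)) by apply/cvg_ex; eexists; exact: cs.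
  move=> h; have /cvg_seq_bounded[M [_ MP]] : cvgn (fun k => a k * s ^+ k) by apply/cvg_ex; exists 0.
  exists (`|M| + 1) => [|k]; first by rewrite ltr_wpDl.
  have := MP (`|M| + 1); rewrite (le_lt_trans (ler_norm _)) ?ltrDl // => /(_ isT k I).
  by rewrite /= normrM [`|s ^+ k|]gtr0_norm ?exprn_gt0.
have akC k : `|a k| * (s / 2) ^+ k <= C * 2^-1 ^+ k.
  by rewrite exprMn mulrA ler_wpM2r // exprn_ge0.
have term k u : `|u| <= s / 2 -> `|a k * u ^+ k| <= C * 2^-1 ^+ k.
  move=> us; apply: le_trans (akC k); rewrite normrM normrX ler_wpM2l // lerXn2r // nnegrE.
  by rewrite ltW // divr_gt0.
have sr : s / 2 < r by rewrite /s; lra.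
have tail d u : `|u| <= s / 2 -> `|f (x0 + u) - series (fun k => a k * u ^+ k) d| <= 2 * C * 2^-1 ^+ d.
  move=> us; have := ax (x0 + u); rewrite [x0 + u]addrC addrK.
  move=> /(_ (le_lt_trans us sr)) cf.
  have cf' : `|series (fun k => a k * u ^+ k) N - series (fun k => a k * u ^+ k) d| @[N --> \oo]
     --> `|f (u + x0) - series (fun k => a k * u ^+ k) d|.
    by apply: cvg_norm; apply: cvgB => //; exact: cvg_cst.
  rewrite -(cvg_lim _ cf') //; apply: limr_le; first by apply/cvg_ex; eexists; exact: cf'.
  exists d => // N /= dN; rewrite sub_series_geq //.
  apply: le_trans (ler_norm_sum _ _ _) _; apply: le_trans (ler_sum _ (fun k _ => term k u us)) _.
  rewrite -mulr_sumr -(subnKC dN); have := sum_half_powers d (N - d).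
  by move/(ler_wpM2l (ltW C0)); rewrite mulrA [C * 2]mulrC.
have lip u w : `|u| <= s / 2 -> `|w| <= s / 2 ->
    `|f (x0 + u) - f (x0 + w)| <= (4 * C / s) * `|u - w|.
  move=> us ws.
  have cu := ax (x0 + u); rewrite [x0 + u]addrC addrK in cu.
  have cw := ax (x0 + w); rewrite [x0 + w]addrC addrK in cw.
  have {cu cw} cf : `|series (fun k => a k * u ^+ k) N - series (fun k => a k * w ^+ k) N| @[N --> \oo]
     --> `|f (u + x0) - f (w + x0)|.
    by apply: cvg_norm; apply: cvgB; [apply: cu | apply: cw]; exact: le_lt_trans sr.
  rewrite ![x0 + _]addrC -(cvg_lim _ cf) //; apply: limr_le; first by apply/cvg_ex; eexists; exact: cf.
  apply: nearW => N; rewrite /series /= -sumrB.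
  apply: le_trans (ler_norm_sum _ _ _) _.
  have term2 k : `|a k * u ^+ k - a k * w ^+ k| <= (2 * C / s * `|u - w|) * (k%:R * 2^-1 ^+ k).
    have := exprB_le k us ws; rewrite -mulrBr normrM => h.
    have s20 : 0 < s / 2 by rewrite divr_gt0.
    rewrite -ler_pdivlMr // in h; apply: le_trans (ler_wpM2l (normr_ge0 _) h) _.
    have -> : `|a k| * (k%:R * (s / 2) ^+ k * `|u - w| / (s / 2)) =
       (`|a k| * (s / 2) ^+ k) * (k%:R * `|u - w| * (2 / s)) by field; rewrite gt_eqF.
    have -> : 2 * C / s * `|u - w| * (k%:R * 2^-1 ^+ k) = C * 2^-1 ^+ k * (k%:R * `|u - w| * (2 / s)).
      by ring.
    by rewrite ler_wpM2r // !mulr_ge0 // invr_ge0 ltW.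
  apply: le_trans (ler_sum _ (fun k _ => term2 k)) _.
  rewrite -mulr_sumr; apply: le_trans (ler_wpM2l _ (sum_index_half_powers N)) _.
    by rewrite !mulr_ge0 // ?invr_ge0 ltW.
  by rewrite le_eqVlt; apply/orP; left; apply/eqP; ring.
(* The summands bound in turn the tail of the series, the Lipschitz constant and the inverse of the
   radius [s / 4]. *)
pose M0 := 2 * C + 4 * C / s + 4 / s.
have h1 : 0 < 4 * C / s by rewrite !mulr_gt0 // invr_gt0.
have h2 : 0 < 4 / s by rewrite mulr_gt0 // invr_gt0.
have M00 : 0 < M0 by rewrite /M0; lra.
have Ms M : M0 <= M -> M^-1 <= s / 4.
  move=> MM; have Mp := lt_le_trans M00 MM.
  rewrite -[s / 4]invrK lef_pV2 ?posrE ?invr_gt0 ?divr_gt0 //.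
  by rewrite invf_div; apply: le_trans MM; rewrite /M0; lra.
exists M0 => // M x MM xx0.
have xs : `|x - x0| < s / 4 by apply: lt_le_trans xx0 (Ms _ (lexx _)).
have near y : `|y - x| < M^-1 -> `|y - x0| <= s / 2.
  move=> yx; have := lt_le_trans yx (Ms _ MM); move: xs.
  have := ler_normD (y - x) (x - x0); rewrite addrA subrK => a1 a2 a3.
  by lra.
have fE y : f y = f (x0 + (y - x0)) by rewrite addrC subrK.
split=> [d|y yx].
  exists (\sum_(k < d) a k *: ('X - x0%:P) ^+ k).
    apply: (leq_trans (size_sum _ _ _)); apply/bigmax_leqP => k _.
    by apply: (leq_trans (size_scale_leq _ _)); rewrite size_exp_XsubC.
  move=> y /near ys; rewrite horner_sum fE.
  have := tail d _ ys; rewrite /series /= big_mkord => h.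
  under eq_bigr do rewrite hornerZ horner_exp hornerXsubC.
  apply: le_trans h _; rewrite ler_wpM2r ?exprn_ge0 //.
  by apply: le_trans MM; rewrite /M0; lra.
have ys := near _ yx; have xs2 : `|x - x0| <= s / 2 by lra.
rewrite (fE x) (fE y); apply: le_trans (lip _ _ xs2 ys) _.
have -> : x - x0 - (y - x0) = x - y by ring.
by rewrite ler_wpM2r //; apply: le_trans MM; rewrite /M0; lra.
Qed.

Lemma periodic1_int (f : R -> R) (z : int) x : periodic1 f -> f (x + z%:~R) = f x.
Proof.
move=> pf; have pn n y : f (y + n%:R) = f y.
  by elim: n => [|n IH]; [rewrite addr0 | rewrite -natr1 addrA pf].
case: z => n; first exact: pn.
by have := pn n.+1 (x - n.+1%:R); rewrite subrK => ->; rewrite NegzE mulrNz.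
Qed.

Lemma analytic_periodic_uniform (f : R -> R) : real_analytic f -> periodic1 f ->
  exists2 M : R, 0 < M & forall x, poly_approx f M x.
Proof.
move=> af pf.
have K : near_covering `[0%R : R, 1%R] by apply/compact_near_coveringP; exact: segment_compact.
have [x _|M [_ MP]] := K R (pinfty_nbhs R) (poly_approx f) _.
  have [M0 M00 M0P] := analytic_poly_approx x af.
  exists (ball x M0^-1, [set M | M0 <= M]) => /=.
    split; first by apply: nbhsx_ballx; rewrite invr_gt0.
    by exists M0; split=> [|y /ltW //]; exact: num_real.
  by move=> [y M] /= [yx MM]; apply: M0P => //; rewrite distrC.
pose M1 := Num.max M 0 + 1.
have M10 : 0 < M1 by rewrite /M1 ltr_wpDl // le_max lexx orbT.
exists M1 => // x.
have Mx y : 0 <= y <= 1 -> poly_approx f M1 y.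
  by move=> y01; apply: (MP M1); [rewrite /M1 ltr_pwDr // le_max lexx | rewrite /= in_itv].
set z := Num.floor x; pose y := x - z%:~R.
have [|P1 P2] := Mx y.
  by have /andP[-> /ltW] := fracpart_itv x.
have shift u : `|u - x| < M1^-1 -> `|u - z%:~R - y| < M1^-1.
  by rewrite /y (_ : u - z%:~R - (x - z%:~R) = u - x) //; ring.
have fz u : f (u - z%:~R) = f u by rewrite -mulrNz periodic1_int.
split=> [d|u ux].
  have [p sp pP] := P1 d; exists (p \Po ('X - (z%:~R)%:P)).
    by rewrite size_comp_poly2 // size_XsubC.
  by move=> u /shift /pP; rewrite horner_comp hornerXsubC fz.
have := P2 _ (shift _ ux); rewrite !fz (_ : y - (u - z%:~R) = x - u) //.
by rewrite /y; ring.
Qed.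

Lemma analytic_bounded_lipschitz (f : R -> R) : real_analytic f -> periodic1 f ->
  exists2 L : R, 0 < L & (forall x, `|f x| <= L) /\ (forall x y, `|f x - f y| <= L * `|x - y|).
Proof.
move=> af pf; have [M M0 MP] := analytic_periodic_uniform af pf.
(* For [d = 0] the approximating polynomial is zero. *)
have fM x : `|f x| <= M.
  have [/(_ 0%N)[p]] := MP x; rewrite leqn0 size_poly_eq0 => /eqP -> h _.
  by have := h x; rewrite subrr normr0 invr_gt0 horner0 subr0 expr0 mulr1; apply.
(* Points at distance at least [1 / M] have values differing by at most [2 M], hence the slope
   [2 M ^ 2]. *)
exists (M + 2 * M * M); first by rewrite addr_gt0 // !mulr_gt0.
have MM0 : 0 < 2 * M * M by rewrite !mulr_gt0.
split=> [x|x y]; first by have := fM x; lra.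
have [xy|xy] := ltP `|y - x| M^-1.
  have [_ /(_ _ xy) h] := MP x; apply: le_trans h _; rewrite ler_wpM2r //; lra.
apply: le_trans (ler_normB _ _) _; apply: le_trans (lerD (fM x) (fM y)) _.
have : 2 * M * M * M^-1 <= 2 * M * M * `|x - y| by rewrite ler_pM2l // distrC.
rewrite mulfK ?gt_eqF // mulrDl; have := mulr_ge0 (ltW M0) (normr_ge0 (x - y)); lra.
Qed.

End PowerSeries.

(** * Transfer matrices, barriers and cut points *)

Section Transfer.
Variable R : realType.

Lemma mx_entry_le m n (A : 'M[R]_(m.+1, n.+1)) i j : `|A i j| <= `|A|.
Proof.
rewrite [leRHS]/Num.norm /= mx_normrE; by apply/bigmax_geP; right => /=; exists (i, j).
Qed.

Lemma mx_norm_le m n (A : 'M[R]_(m.+1, n.+1)) c : (forall i j, `|A i j| <= c) -> `|A| <= c.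
Proof.
move=> Ac; rewrite [leLHS]/Num.norm /= mx_normrE; apply/bigmax_leP; split=> [|[i j] _]; last exact: Ac.
exact: le_trans (normr_ge0 _) (Ac ord0 ord0).
Qed.


Lemma mulmx2E p (A : 'M[R]_2) (B : 'M[R]_(2, p)) i j :
  (A *m B) i j = A i 0 * B 0 j + A i 1 * B 1 j.
Proof.
rewrite mxE !big_ord_recl big_ord0 addr0; congr (_ + A i _ * B _ j); exact: val_inj.
Qed.

Lemma mulmx2_norm_le p (A : 'M[R]_2) (B : 'M[R]_(2, p.+1)) : `|A *m B| <= 2 * `|A| * `|B|.
Proof.
apply: mx_norm_le => i j; rewrite mulmx2E; apply: le_trans (ler_normD _ _) _; rewrite !normrM.
have h k : `|A i k| * `|B k j| <= `|A| * `|B| by apply: ler_pM => //; exact: mx_entry_le.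
by have := h 0; have := h 1; lra.
Qed.

Lemma det2E (A : 'M[R]_2) : \det A = A 0 0 * A 1 1 - A 0 1 * A 1 0.
Proof.
rewrite (expand_det_row _ 0) !big_ord_recl big_ord0 addr0 /cofactor !det_mx11 !mxE /=.
rewrite !expr0 mul1r expr1 mulN1r mulrN.
by congr (A _ _ * A _ _ - A _ _ * A _ _); exact: val_inj.
Qed.

Variable v : int -> R.

(** The potential [v] already contains [- E]. Matrices start at any integer site, since windows are
    placed all along the line. *)
Definition stepmx (n : int) : 'M[R]_2 := \matrix_(i < 2, j < 2)
    (if (i == 0) && (j == 0) then - v n
     else if (i == 0) && (j == 1) then -1
     else if (i == 1) && (j == 0) then 1 else 0).

Fixpoint tm (i : int) (n : nat) : 'M[R]_2 :=
  match n with
  | 0 => 1%:M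
  | n.+1 => stepmx (i + n%:Z) *m tm i n
  end.

Lemma tm_cat i m n : tm i (m + n) = tm (i + m%:Z) n *m tm i m.
Proof.
elim: n => [|n IH]; first by rewrite addn0 mul1mx.
by rewrite addnS /= IH mulmxA PoszD addrA.
Qed.

Lemma det_tm i n : \det (tm i n) = 1.
Proof.
elim: n => [|n IH] /=; first exact: det1.
by rewrite det_mulmx IH mulr1 det2E !mxE /=; ring.
Qed.

Variable V : R.
Hypothesis vV : forall n, `|v n| <= V.

Lemma stepmx_norm n : `|stepmx n| <= V + 1.
Proof.
have V0 := le_trans (normr_ge0 _) (vV n).
apply: mx_norm_le => i j; rewrite mxE.
case: ifP => _; first by rewrite normrN (le_trans (vV n)) // lerDl.
case: ifP => _; first by rewrite normrN normr1 lerDr.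
by case: ifP => _; rewrite ?normr1 ?normr0 ?lerDr // addr_ge0.
Qed.

Let K := 2 * (V + 1).
Let K1 : 1 <= K. Proof. by rewrite /K; have := le_trans (normr_ge0 _) (vV 0); lra. Qed.

Lemma tm_norm i n : `|tm i n| <= K ^+ n.
Proof.
elim: n => [|n IH] /=.
  by apply: mx_norm_le => r s; rewrite mxE expr0; case: eqP => _; rewrite ?normr1 ?normr0.
apply: le_trans (mulmx2_norm_le _ _) _; rewrite exprS; apply: ler_pM => //.
by rewrite /K ler_pM2l // stepmx_norm.
Qed.

Definition state (psi : int -> R) (n : int) : 'cV[R]_2 :=
  \col_(r < 2) (if r == 0 then psi n else psi (n - 1)).

Lemma state_succ psi n : state psi (n + 1) =
  stepmx n *m state psi n + \col_(r < 2) (if r == 0 then hop v psi n else 0).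
Proof.
apply/matrixP => r s; rewrite !mxE !big_ord_recl big_ord0 !mxE /=.
case: r => [[|[|//]] r2] /=; rewrite ?(addrK 1) /hop /=; ring.
Qed.

Lemma state_le psi n c : `|psi n| <= c -> `|psi (n - 1)| <= c -> `|state psi n| <= c.
Proof. by move=> h1 h2; apply: mx_norm_le => r s; rewrite mxE; case: ifP. Qed.

(** The factor [K ^ n] is affordable because it multiplies only the defect [hop v psi], which is
    made small last. *)
Lemma state_transfer psi i n s : (forall k, (k < n)%N -> `|hop v psi (i + k%:Z)| <= s) ->
  0 <= s -> `|state psi (i + n%:Z) - tm i n *m state psi i| <= n%:R * K ^+ n * s.
Proof.
move=> ps s0; elim: n ps => [|n IH] ps.
  by rewrite addr0 mul1mx subrr normr0 !mul0r.
rewrite (_ : i + n.+1%:Z = i + n%:Z + 1); last by rewrite -addrA -PoszD addn1.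
rewrite state_succ /= -mulmxA addrAC -mulmxBr.
apply: le_trans (ler_normD _ _) _.
have h1 : `|\col_(r < 2) (if r == 0 then hop v psi (i + n%:Z) else 0)| <= s.
  by apply: mx_norm_le => r t; rewrite mxE; case: ifP; rewrite ?normr0 // ps.
have /IH h2 k : (k < n)%N -> `|hop v psi (i + k%:Z)| <= s by move=> kn; apply: ps; exact: ltnW.
have h3 := mulmx2_norm_le (stepmx (i + n%:Z)) (state psi (i + n%:Z) - tm i n *m state psi i).
have h4 : 2 * `|stepmx (i + n%:Z)| * `|state psi (i + n%:Z) - tm i n *m state psi i| <=
   K * (n%:R * K ^+ n * s).
  by apply: ler_pM => //; rewrite ?mulr_ge0 // /K ler_pM2l // stepmx_norm.
have K0 : 1 <= K ^+ n.+1 by exact: exprn_ege1.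
have h5 : s <= K ^+ n.+1 * s by rewrite ler_peMl.
apply: le_trans (lerD (le_trans h3 h4) h1) _.
have -> : n.+1%:R * K ^+ n.+1 * s = K * (n%:R * K ^+ n * s) + K ^+ n.+1 * s.
  by rewrite -natr1 exprS; ring.
by rewrite lerD2l.
Qed.

(* With [b] a row of [B] and [p] a column of [A] such that [b.p] is the largest
   entry of [B A], the vector [w] is recovered from [b.w] and [p ^ w]. *)
Lemma barrier_estimate (L : R) i a b psi : 0 < L ->
  L * `|tm i a| <= `|tm i (a + b)| -> L * `|tm (i + a%:Z) b| <= `|tm i (a + b)| ->
  `|state psi (i + a%:Z)| <= L^-1 * (`|state psi i| + `|state psi (i + a%:Z + b%:Z)| +
     `|state psi (i + a%:Z + b%:Z) - tm (i + a%:Z) b *m state psi (i + a%:Z)| +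
     2 * `|tm i a| * `|state psi (i + a%:Z) - tm i a *m state psi i|).
Proof.
move=> L0; rewrite tm_cat.
have := det_tm i a; rewrite det2E.
move: (tm i a) (tm _ b) (state psi i) (state psi (i + a%:Z)) (state psi (i + a%:Z + b%:Z)) => A B x w y.
move=> detA LA LB.
have A0 : 0 < `|A|.
  rewrite lt_neqAle normr_ge0 andbT eq_sym normr_eq0; apply/eqP => A0.
  by move: detA; rewrite A0 !mxE => /eqP; rewrite !mul0r subrr eq_sym oner_eq0.
have T0 : 0 < `|B *m A| by apply: lt_le_trans LA; exact: mulr_gt0.
have [[r s] /= Trs] := mx_norm_neq0 (lt0r_neq0 T0).
have Trs' : `|B *m A| = `|(B *m A) r s| by exact: Trs.
have [e2 [e2E Bw]] : exists e2, y - B *m w = e2 /\ B *m w = y - e2.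
  by exists (y - B *m w); rewrite subKr.
have [e1 [e1E we]] : exists e1, w - A *m x = e1 /\ w = A *m x + e1.
  by exists (w - A *m x); rewrite [A *m x + _]addrC subrK.
rewrite e2E e1E.
have bw : `|(B *m w) r 0| <= `|y| + `|e2|.
  have -> : (B *m w) r 0 = y r 0 - e2 r 0 by rewrite Bw !mxE.
  by apply: le_trans (ler_normB _ _) _; apply: lerD; exact: mx_entry_le.
have pw : `|w 0 0 * A 1 s - w 1 0 * A 0 s| <= `|x| + 2 * `|A| * `|e1|.
  have wE k : w k 0 = A k 0 * x 0 0 + A k 1 * x 1 0 + e1 k 0 by rewrite we mxE mulmx2E.
  rewrite !wE.
  (* Since [det A = 1], the wedge of [A x] with column [s] of [A] is, up to sign, the coordinate of
     [x] of index other than [s]. *)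
  have [t xt] : exists t, `|(A 0 0 * x 0 0 + A 0 1 * x 1 0) * A 1 s -
      (A 1 0 * x 0 0 + A 1 1 * x 1 0) * A 0 s| = `|x t 0|.
    case: (s =P 0) => [->|/eqP s0].
      exists 1; rewrite -normrN -[x 1 0 in RHS]mul1r -detA.
      by congr `|_|; ring.
    exists 0; have -> : s = 1 by case: s s0 {Trs Trs'} => [[|[|//]] ?] //= _; exact: val_inj.
    by rewrite -[x 0 0 in RHS]mul1r -detA; congr `|_|; ring.
  have -> : (A 0 0 * x 0 0 + A 0 1 * x 1 0 + e1 0 0) * A 1 s -
      (A 1 0 * x 0 0 + A 1 1 * x 1 0 + e1 1 0) * A 0 s =
     ((A 0 0 * x 0 0 + A 0 1 * x 1 0) * A 1 s - (A 1 0 * x 0 0 + A 1 1 * x 1 0) * A 0 s)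
     + (e1 0 0 * A 1 s - e1 1 0 * A 0 s) by ring.
  apply: le_trans (ler_normD _ _) _; rewrite xt; apply: lerD; first exact: mx_entry_le.
  apply: le_trans (ler_normB _ _) _; rewrite !normrM.
  have h k k' : `|e1 k 0| * `|A k' s| <= `|e1| * `|A| by apply: ler_pM => //; exact: mx_entry_le.
  by have := h 0 1; have := h 1 0; lra.
have wT : `|w| * `|B *m A| <= (`|y| + `|e2|) * `|A| + (`|x| + 2 * `|A| * `|e1|) * `|B|.
  rewrite -ler_pdivlMr //; apply: mx_norm_le => k l; rewrite ler_pdivlMr // Trs' -normrM.
  rewrite [l]ord1 mulmx2E.
  (* Cramer's rule for the system given by [b.w] and the wedge of [w] with [p], whose determinant is
     [b.p]. *)
  have key : exists k', w k 0 * (B r 0 * A 0 s + B r 1 * A 1 s) = (B *m w) r 0 * A k s +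
     (w 0 0 * A 1 s - w 1 0 * A 0 s) * (if k == 0 then B r k' else - B r k').
    rewrite mulmx2E; case: k => [[|[|//]] k2].
      by exists 1; rewrite (_ : Ordinal k2 = 0) /=; [ring | exact: val_inj].
    by exists 0; rewrite (_ : Ordinal k2 = 1) /=; [ring | exact: val_inj].
  have [k' ->] := key; apply: le_trans (ler_normD _ _) _; rewrite !normrM.
  apply: lerD; apply: ler_pM => //; first exact: mx_entry_le.
  by case: ifP => _; rewrite ?normrN mx_entry_le.
rewrite mulrC ler_pdivlMr // mulrC -(ler_pM2r T0).
apply: le_trans (_ : L * ((`|y| + `|e2|) * `|A| + (`|x| + 2 * `|A| * `|e1|) * `|B|) <= _).
  by rewrite -[leLHS]mulrA; apply: ler_wpM2l => //; exact: ltW.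
have -> : L * ((`|y| + `|e2|) * `|A| + (`|x| + 2 * `|A| * `|e1|) * `|B|) =
   (`|y| + `|e2|) * (L * `|A|) + (`|x| + 2 * `|A| * `|e1|) * (L * `|B|) by ring.
have -> : (`|x| + `|y| + `|e2| + 2 * `|A| * `|e1|) * `|B *m A| =
   (`|y| + `|e2|) * `|B *m A| + (`|x| + 2 * `|A| * `|e1|) * `|B *m A| by ring.
by apply: lerD; apply: ler_wpM2l => //; rewrite addr_ge0 // !mulr_ge0.
Qed.

(** If the midpoint is no barrier, one half inherits the hypothesis with [j] lowered by one. After
    [j] failures a single step would exceed [V + 1]. *)
Lemma barrier_scale (L : R) j i : 0 < L -> (V + 1) * L ^+ j < `|tm i (2 ^ j)| ->
  exists i' k, [/\ i <= i', i' + (2 ^ k + 2 ^ k)%N%:Z <= i + (2 ^ j)%N%:Z,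
    L * `|tm i' (2 ^ k)| <= `|tm i' (2 ^ k + 2 ^ k)| &
    L * `|tm (i' + (2 ^ k)%N%:Z) (2 ^ k)| <= `|tm i' (2 ^ k + 2 ^ k)|].
Proof.
move=> L0; elim: j i => [|j IH] i.
  rewrite expr0 mulr1 expn0 /= addr0 mulmx1 ltNge => /negP[]; exact: stepmx_norm.
have -> : (2 ^ j.+1)%N = (2 ^ j + 2 ^ j)%N by rewrite expnS mul2n addnn.
move=> big.
have [hA|hA] := leP (L * `|tm i (2 ^ j)|) `|tm i (2 ^ j + 2 ^ j)|; last first.
  have [|i' [k [h1 h2 h3 h4]]] := IH i.
    by rewrite -(ltr_pM2l L0) mulrCA -exprS; exact: lt_trans big hA.
  by exists i', k; split=> //; apply: le_trans h2 _; rewrite lerD2l lez_nat leq_addr.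
have [hB|hB] := leP (L * `|tm (i + (2 ^ j)%N%:Z) (2 ^ j)|) `|tm i (2 ^ j + 2 ^ j)|; last first.
  have [|i' [k [h1 h2 h3 h4]]] := IH (i + (2 ^ j)%N%:Z).
    by rewrite -(ltr_pM2l L0) mulrCA -exprS; exact: lt_trans big hB.
  exists i', k; split=> //; last by apply: le_trans h2 _; rewrite -addrA -PoszD.
  by apply: le_trans h1; rewrite lerDl.
by exists i, j.
Qed.

(** The order of quantifiers is essential: [C] depends on neither [psi] nor the position [i], so one
    constant serves all windows and [psi] can be adapted to it. *)
Lemma cut_point (L : R) j : 0 < L -> exists2 C : R, 0 <= C &
  forall psi i, (V + 1) * L ^+ j < `|tm i (2 ^ j)| ->
  exists x : int, i < x <= i + (2 ^ j)%N%:Z /\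
    psi x ^+ 2 + psi (x - 1) ^+ 2 <=
      16 * L ^- 2 * \sum_(0 <= k < 2 ^ j + 2) psi (i - 1 + k%:Z) ^+ 2 +
      C * \sum_(0 <= k < 2 ^ j) hop v psi (i + k%:Z) ^+ 2.
Proof.
move=> L0; pose N := (2 ^ j)%N.
(* The two summands are the transfer errors of the right half and of the left half in
   [barrier_estimate], the latter amplified by [2 |A|]. *)
pose D := N%:R * K ^+ N + 2 * K ^+ N * (N%:R * K ^+ N).
have K0 : 0 <= K by apply: le_trans K1.
have KN n : 0 <= K ^+ n by exact: exprn_ge0.
have D0 : 0 <= D by rewrite /D addr_ge0 // !mulr_ge0.
exists (4 * (L ^- 2 * D ^+ 2)).
  by rewrite !mulr_ge0 ?sqr_ge0 // invr_ge0 exprn_ge0 // ltW.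
move=> psi i /(barrier_scale L0)[i' [k [ii' i'j LA LB]]].
have k0 : (0 < 2 ^ k)%N by rewrite expn_gt0.
rewrite -/N in i'j; have kN : (2 ^ k <= N)%N by move: ii' i'j; clear; lia.
exists (i' + (2 ^ k)%N%:Z); split.
  by move: k0 ii' i'j; rewrite -/N; clear; move: (2 ^ k)%N (2 ^ j)%N; lia.
set S1 := \sum_(0 <= _ < 2 ^ j + 2) _; set S2 := \sum_(0 <= _ < 2 ^ j) _.
have S10 : 0 <= S1 by apply: sumr_ge0 => *; exact: sqr_ge0.
have S20 : 0 <= S2 by apply: sumr_ge0 => *; exact: sqr_ge0.
have norm_sqrt (u S : R) : u ^+ 2 <= S -> `|u| <= Num.sqrt S.
  by move=> uS; rewrite -sqrtr_sqr; exact: ler_wsqrtr.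
have P1 n : i - 1 <= n <= i + N%:Z -> `|psi n| <= Num.sqrt S1.
  move=> /andP[n1 n2]; apply: norm_sqrt.
  have [q qN nq] : exists2 q : nat, (q < 2 ^ j + 2)%N & n = i - 1 + q%:Z.
    by exists `|(n - (i - 1))%R|%N; move: n1 n2; rewrite /N; clear; lia.
  rewrite nq /S1 big_mkord (bigD1 (Ordinal qN)) //= lerDl.
  by apply: sumr_ge0 => *; exact: sqr_ge0.
have P2 n : i <= n < i + N%:Z -> `|hop v psi n| <= Num.sqrt S2.
  move=> /andP[n1 n2]; apply: norm_sqrt.
  have [q qN nq] : exists2 q : nat, (q < 2 ^ j)%N & n = i + q%:Z.
    by exists `|(n - i)%R|%N; move: n1 n2; rewrite /N; clear; lia.
  rewrite nq /S2 big_mkord (bigD1 (Ordinal qN)) //= lerDl.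
  by apply: sumr_ge0 => *; exact: sqr_ge0.
have st n : i <= n <= i + N%:Z -> `|state psi n| <= Num.sqrt S1.
  by move=> /andP[n1 n2]; apply: state_le; apply: P1; move: n1 n2; clear; lia.
have tr n : i <= n -> n + (2 ^ k)%N%:Z <= i + N%:Z ->
    `|state psi (n + (2 ^ k)%N%:Z) - tm n (2 ^ k) *m state psi n| <=
      N%:R * K ^+ N * Num.sqrt S2.
  move=> n1 n2; apply: le_trans (state_transfer _ (sqrtr_ge0 S2)) _.
    by move=> q qk; apply: P2; move: n1 n2 qk; clear; lia.
  by apply: ler_wpM2r; rewrite ?sqrtr_ge0 //; apply: ler_pM; rewrite ?ler_nat // ler_weXn2l.
have main := barrier_estimate psi L0 LA LB.
have h1 : `|state psi i'| <= Num.sqrt S1 by apply: st; move: ii' i'j; clear; lia.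
have h2 : `|state psi (i' + (2 ^ k)%N%:Z + (2 ^ k)%N%:Z)| <= Num.sqrt S1.
  by apply: st; move: ii' i'j; clear; lia.
have h3 := tr (i' + (2 ^ k)%N%:Z); have h4 := tr i'.
have h5 : 2 * `|tm i' (2 ^ k)| <= 2 * K ^+ N.
  by rewrite ler_pM2l //; apply: le_trans (tm_norm _ _) _; rewrite ler_weXn2l.
have {}main : `|state psi (i' + (2 ^ k)%N%:Z)| <= L^-1 * (2 * Num.sqrt S1 + D * Num.sqrt S2).
  apply: le_trans main _; rewrite ler_pM2l ?invr_gt0 //.
  have -> : 2 * Num.sqrt S1 + D * Num.sqrt S2 = Num.sqrt S1 + Num.sqrt S1 +
    N%:R * K ^+ N * Num.sqrt S2 + 2 * K ^+ N * (N%:R * K ^+ N * Num.sqrt S2) by rewrite /D; ring.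
  apply: lerD; last by apply: ler_pM => //; rewrite ?mulr_ge0 //; apply: h4; move: ii' i'j; clear; lia.
  by apply: lerD; [exact: lerD | apply: h3; move: ii' i'j; clear; lia].
set x := i' + (2 ^ k)%N%:Z in main *.
set U := L^-1 * (2 * Num.sqrt S1 + D * Num.sqrt S2) in main.
have U0 : 0 <= U by exact: le_trans main.
have e1 : psi x ^+ 2 <= U ^+ 2.
  rewrite -real_normK ?num_real // lerXn2r // ?nnegrE //; apply: le_trans main.
  by have := mx_entry_le (state psi x) 0 0; rewrite mxE.
have e2 : psi (x - 1) ^+ 2 <= U ^+ 2.
  rewrite -real_normK ?num_real // lerXn2r // ?nnegrE //; apply: le_trans main.
  by have := mx_entry_le (state psi x) 1 0; rewrite mxE.
apply: le_trans (lerD e1 e2) _.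
have U2 : U ^+ 2 <= L ^- 2 * (8 * S1 + 2 * D ^+ 2 * S2).
  rewrite /U exprMn exprVn ler_wpM2l ?invr_ge0 ?exprn_ge0 ?(ltW L0) //.
  have s1 := sqr_sqrtr S10; have s2 := sqr_sqrtr S20.
  rewrite -[in leRHS]s1 -[in leRHS]s2.
  by have := sqr_ge0 (2 * Num.sqrt S1 - D * Num.sqrt S2); nra.
apply: le_trans (lerD U2 U2) _; rewrite le_eqVlt; apply/orP; left; apply/eqP; ring.
Qed.

End Transfer.

(** * Cutting a vector into localized pieces *)

Section Pieces.
Variable R : realType.
Implicit Types (psi chi v : int -> R) (x : int -> int).

Lemma divz_block (k : int) (L i : nat) : (i < L)%N -> ((k * L%:Z + i%:Z)%R %/ L%:Z)%Z = k.
Proof.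
move=> iL; rewrite divzMDl ?divz_small ?addr0 //; last by case: L iL.
Qed.

Lemma divz_blockP (n : int) (L : nat) : (0 < L)%N ->
  exists2 i : nat, (i < L)%N & n = (n %/ L%:Z)%Z * L%:Z + i%:Z.
Proof.
move=> L0; have L0' : L%:Z != 0 by case: L L0.
exists `|(n %% L%:Z)%Z|%N; last by rewrite gez0_abs ?modz_ge0 // -divz_eq.
by have := ltz_mod n L0'; have := modz_ge0 n L0'; clear; lia.
Qed.

Lemma divz_block_pred (n : int) (L : nat) : (0 < L)%N ->
  ((n - 1)%R %/ L%:Z)%Z = (n %/ L%:Z)%Z \/
  ((n - 1)%R %/ L%:Z)%Z = (n %/ L%:Z)%Z - 1 /\ n = (n %/ L%:Z)%Z * L%:Z.
Proof.
move=> L0; have [[|i] iL {1 3 5}->] := divz_blockP n L0; [right|left].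
  rewrite addr0; split=> //.
  rewrite (_ : _ - 1 = ((n %/ L%:Z)%Z - 1) * L%:Z + L.-1%:Z) ?divz_block ?prednK //.
  by case: L L0 {iL} => // L _; rewrite /= mulrBl mul1r -addrA; congr (_ + _); lia.
rewrite (_ : _ - 1 = (n %/ L%:Z)%Z * L%:Z + i%:Z) ?divz_block //; first exact: ltnW.
by rewrite -addrA; congr (_ + _); lia.
Qed.

Lemma fsum_block (L : nat) (G : int -> R) : (0 < L)%N -> fsupp G ->
  fsum G = fsum (fun k : int => \sum_(0 <= i < L) G (k * L%:Z + i%:Z)).
Proof.
move=> L0 [r rG]; pose w n := (n %/ L%:Z)%Z.
have -> : fsum G = fsum (fun n => fsum (fun k => (k == w n)%:R * G n)).
  by apply: eq_fsum => n; rewrite fsum_delta.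
rewrite (@fsum_exchange _ _ _ _ r [seq w n | n <- r]); first last.
- move=> n k kr; have [e|_] := eqVneq k (w n); last by rewrite mul0r.
  by rewrite mul1r; apply: rG; apply: contra kr => nr; rewrite e; exact: map_f.
- by move=> n k /rG ->; rewrite mulr0.
apply: eq_fsum => k.
rewrite (@fsum_seq _ _ [seq k * L%:Z + i%:Z | i <- iota 0 L]).
- rewrite big_map /index_iota subn0; apply: eq_big_seq => i; rewrite mem_iota => /andP[_ iL].
  by rewrite /w divz_block // eqxx mul1r.
- by rewrite map_inj_uniq ?iota_uniq // => i j /addrI [].
move=> n nr; case: eqP => [kw|_]; last by rewrite mul0r.
case/negP: nr; have [i iL e] := divz_blockP n L0.
by apply/mapP; exists i; rewrite ?mem_iota // kw.
Qed.

(** With one cut [x k] inside block [k], piece [k] is [[x (k - 1), x k[]. It lies in two adjacent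
    blocks, whence the length [2 L]. *)
Definition piece (L : nat) x (n : int) : int :=
  let k := (n %/ L%:Z)%Z in k + (nat_of_bool (x k <= n)%R)%:Z.

Lemma piece_cut (L : nat) x n : (0 < L)%N ->
  (forall k, k * L%:Z < x k < (k + 1) * L%:Z) ->
  piece L x (n - 1) != piece L x n -> n = x (n %/ L%:Z)%Z.
Proof.
move=> L0 xL; rewrite /piece.
have [h|h] := divz_block_pred n L0.
  by rewrite h; move: (x _) => y; case: leP; case: leP => //=; lia.
case: h => -> h; have /andP[h1 h2] := xL ((n %/ L%:Z)%Z - 1).
have /andP[h3 h4] := xL (n %/ L%:Z)%Z.
rewrite subrK -h in h2; rewrite -h in h3.
rewrite (_ : (_ <= n - 1) = true); last by move: h2; clear; lia.
rewrite (_ : (_ <= n) = false); last by move: h3; clear; lia.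
by rewrite /= addr0 subrK eqxx.
Qed.

Lemma piece_supp (L : nat) x n : (0 < L)%N ->
  (forall k, k * L%:Z < x k < (k + 1) * L%:Z) ->
  (piece L x n - 1) * L%:Z <= n < (piece L x n - 1) * L%:Z + (2 * L)%N%:Z.
Proof.
move=> L0 xL; rewrite /piece; have := xL (n %/ L%:Z)%Z.
have [i iL e] := divz_blockP n L0.
by move: (x _) e => y; move: (n %/ L%:Z)%Z => k ->; case: leP => /=; move: iL; clear; nia.
Qed.

Definition restrict_piece (p : int -> int) psi (k : int) : int -> R :=
  fun n => (k == p n)%:R * psi n.

(** The commutator of [hop v] with the indicator of a piece lives at the jumps of [p]. The bound is
    linear in the indicators, so that it can be summed over all pieces. *)
Lemma hop_restrict_sqr_le v (p : int -> int) psi k n :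
  hop v (restrict_piece p psi k) n ^+ 2 <=
  (k == p n)%:R * (3 * (hop v psi n ^+ 2 + (p (n - 1) != p n)%:R * psi (n - 1) ^+ 2 +
                         (p n != p (n + 1))%:R * psi (n + 1) ^+ 2)) +
  (k == p (n - 1))%:R * (3 * ((p (n - 1) != p n)%:R * psi (n - 1) ^+ 2)) +
  (k == p (n + 1))%:R * (3 * ((p n != p (n + 1))%:R * psi (n + 1) ^+ 2)).
Proof.
pose e (m : int) : R := (k == p m)%:R.
have e2 m : e m ^+ 2 = e m by rewrite /e; case: eqP; rewrite ?expr1n ?expr0n.
have d1 : (e (n - 1) - e n) ^+ 2 <= (p (n - 1) != p n)%:R * (e (n - 1) + e n).
  have [h|_] := eqVneq (p (n - 1)) (p n); first by rewrite /e h subrr mul0r expr0n.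
  have e0 m : 0 <= e m by rewrite /e ler0n.
  rewrite mul1r sqrrB !e2 -subr_ge0 opprD opprB !addrA.
  by have := mulr_ge0 (e0 (n - 1)) (e0 n); lra.
have d2 : (e (n + 1) - e n) ^+ 2 <= (p n != p (n + 1))%:R * (e (n + 1) + e n).
  have [h|_] := eqVneq (p n) (p (n + 1)); first by rewrite /e h subrr mul0r expr0n.
  have e0 m : 0 <= e m by rewrite /e ler0n.
  rewrite mul1r sqrrB !e2 -subr_ge0 opprD opprB !addrA.
  by have := mulr_ge0 (e0 (n + 1)) (e0 n); lra.
have -> : hop v (restrict_piece p psi k) n =
   e n * hop v psi n + (e (n - 1) - e n) * psi (n - 1) + (e (n + 1) - e n) * psi (n + 1).
  by rewrite /hop /restrict_piece -!/(e _); ring.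
rewrite -!/(e _).
apply: le_trans (_ : 3 * (e n * hop v psi n ^+ 2 + (e (n - 1) - e n) ^+ 2 * psi (n - 1) ^+ 2 +
   (e (n + 1) - e n) ^+ 2 * psi (n + 1) ^+ 2) <= _).
  have -> : e n * hop v psi n ^+ 2 = (e n * hop v psi n) ^+ 2 by rewrite exprMn e2.
  rewrite -!exprMn; move: (e n * _) (_ * psi (n - 1)) (_ * psi (n + 1)) => a b c.
  by have := sqr_ge0 (a - b); have := sqr_ge0 (b - c); have := sqr_ge0 (a - c); nra.
have h1 := ler_wpM2r (sqr_ge0 (psi (n - 1))) d1.
have h2 := ler_wpM2r (sqr_ge0 (psi (n + 1))) d2.
by lra.
Qed.

(** Pigeonhole: if no piece were good, summation over the pieces would bound [8 kappa |psi| ^ 2] by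
    [(3 + 6 C) |h psi| ^ 2 + 6 kappa |psi| ^ 2], which is at most [7 kappa |psi| ^ 2]. *)
Lemma localize v psi (L : nat) x (kappa C eta : R) : (0 < L)%N ->
  (forall k, k * L%:Z < x k < (k + 1) * L%:Z) ->
  (forall k, psi (x k) ^+ 2 + psi (x k - 1) ^+ 2 <=
     kappa * \sum_(0 <= i < L) psi (k * L%:Z + i%:Z) ^+ 2 +
     C * \sum_(0 <= i < L) hop v psi (k * L%:Z + i%:Z) ^+ 2) ->
  0 < kappa -> 0 <= C -> (3 + 6 * C) * eta <= kappa ->
  fsupp psi -> 0 < nrm2 psi -> nrm2 (hop v psi) <= eta * nrm2 psi ->
  exists (a : int) chi, [/\ fsupp chi, 0 < nrm2 chi,
    nrm2 (hop v chi) <= 8 * kappa * nrm2 chi &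
    forall n, chi n != 0 -> a <= n < a + (2 * L)%N%:Z].
Proof.
move=> L0 xL cut k0 C0 etak fpsi psi0 small.
pose p := piece L x; pose chi := restrict_piece p psi.
apply: contrapT => none.
have big k : 8 * kappa * nrm2 (chi k) <= nrm2 (hop v (chi k)).
  rewrite leNgt; apply/negP => lt; apply: none.
  exists ((k - 1) * L%:Z), (chi k); split; [exact: fsuppMr | | exact: ltW |].
    rewrite lt_neqAle nrm2_ge0 andbT; apply/eqP => z.
    by move: lt; rewrite -z mulr0 ltNge nrm2_ge0.
  move=> n; rewrite /chi /restrict_piece; case: (k =P p n) => [-> _|_]; last by rewrite mul0r eqxx.
  exact: piece_supp.
have fphi : fsupp (hop v psi) by exact: fsupp_hop.
pose g n := psi (n - 1) ^+ 2 + psi n ^+ 2.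
pose dl n : R := (p (n - 1) != p n)%:R.
pose F k n := (k == p n)%:R * (3 * (hop v psi n ^+ 2 + dl n * psi (n - 1) ^+ 2 +
                         dl (n + 1) * psi (n + 1) ^+ 2)) +
  (k == p (n - 1))%:R * (3 * (dl n * psi (n - 1) ^+ 2)) +
  (k == p (n + 1))%:R * (3 * (dl (n + 1) * psi (n + 1) ^+ 2)).
have chiF k n : hop v (chi k) n ^+ 2 <= F k n.
  by have := hop_restrict_sqr_le v p psi k n; rewrite /F /dl addrK.
have [s0 s0P] := fpsi; have [s1 s1P] := fphi.
pose s := s0 ++ s1 ++ [seq n + 1 | n <- s0] ++ [seq n - 1 | n <- s0].
have sP n : n \notin s -> [/\ psi n = 0, hop v psi n = 0, psi (n - 1) = 0 & psi (n + 1) = 0].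
  rewrite !mem_cat !negb_or => /and4P[/s0P -> /s1P -> h1 h2]; split=> //; apply: s0P.
    by apply: contra h1 => h; apply/mapP; exists (n - 1); rewrite ?subrK.
  by apply: contra h2 => h; apply/mapP; exists (n + 1); rewrite ?addrK.
pose r := [seq p n | n <- s] ++ [seq p (n - 1) | n <- s] ++ [seq p (n + 1) | n <- s].
have Fs k n : n \notin s -> F k n = 0.
  by move=> /sP[_ h1 h2 h3]; rewrite /F h1 h2 h3 expr0n /= !(mulr0, addr0).
have Fr k n : k \notin r -> F k n = 0.
  move=> kr; have [ns|] := boolP (n \in s); last exact: Fs.
  move: kr; rewrite !mem_cat !negb_or => /and3P[h1 h2 h3].
  have ne (q : int -> int) : k \notin [seq q n | n <- s] -> (k == q n) = false.
    by move=> h; apply/eqP => e; move/negP: h; apply; rewrite e; apply: map_f.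
  by rewrite /F (ne p) // (ne (fun n => p (n - 1))) // (ne (fun n => p (n + 1))) // !mul0r !addr0.
have F0 k n : 0 <= F k n by apply: le_trans (chiF k n); exact: sqr_ge0.
have fF k : fsupp (F k) by exists s => n; exact: Fs.
have fchi k : fsupp (chi k) by exact: fsuppMr.
have sum_chi : fsum (fun k => nrm2 (chi k)) = nrm2 psi.
  under [X in fsum X]funext => k do rewrite nrm2_sq.
  rewrite (@fsum_exchange _ _ _ (fun k n => chi k n ^+ 2) r s).
  - rewrite nrm2_sq; apply: eq_fsum => n.
    rewrite -[RHS](fsum_delta (p n)); apply: eq_fsum => k.
    by rewrite /chi /restrict_piece exprMn; case: (k == p n); rewrite ?expr1n ?expr0n.
  - move=> k n; rewrite !mem_cat !negb_or => /and3P[h _ _].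
    rewrite /chi /restrict_piece; case: eqP => e; last by rewrite mul0r expr0n.
    have [ns|/sP[-> _ _ _]] := boolP (n \in s); last by rewrite mulr0 expr0n.
    by case/negP: h; rewrite e; apply: map_f.
  - by move=> k n /sP[h _ _ _]; rewrite /chi /restrict_piece h mulr0 expr0n.
(* Each jump is charged with weight [3] to the pieces on both of its sides, whence [6]. *)
have sum_F : fsum (fun k => fsum (F k)) =
   3 * nrm2 (hop v psi) + 6 * fsum (fun n => dl n * g n).
  rewrite (fsum_exchange Fr Fs).
  have fd (q : int) a : fsupp (fun k => (k == q)%:R * a).
    by exists [:: q] => k; rewrite inE => /negPf ->; rewrite mul0r.
  have -> : fsum (fun n => fsum (F^~ n)) = fsum (fun n => 3 * hop v psi n ^+ 2 +
      (6 * (dl n * psi (n - 1) ^+ 2) + 6 * (dl (n + 1) * psi (n + 1) ^+ 2))).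
    apply: eq_fsum => n; rewrite /F fsumD ?fsumD ?fsum_delta //; try exact: fsuppD.
    by ring.
  have f1 : fsupp (fun n => 6 * (dl n * psi (n - 1) ^+ 2)).
    by do 2!apply: fsuppMr; apply: fsupp_sqr; exact: fsupp_shift.
  have f2 : fsupp (fun n => 6 * (dl (n + 1) * psi (n + 1) ^+ 2)).
    by do 2!apply: fsuppMr; apply: fsupp_sqr; exact: fsupp_shift.
  have f3 : fsupp (fun n => 3 * hop v psi n ^+ 2) by apply: fsuppMr; exact: fsupp_sqr.
  rewrite fsumD //; last exact: fsuppD.
  rewrite fsumD // fsumZ -nrm2_sq !fsumZ; congr (_ + _).
  rewrite (fsum_shift (fun n => dl n * psi n ^+ 2)) -mulrDr -fsumD.
  - by congr (6 * _); apply: eq_fsum => n; rewrite -mulrDr.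
  - by apply: fsuppMr; apply: fsupp_sqr; exact: fsupp_shift.
  - by apply: fsuppMr; apply: fsupp_sqr.
have fdg : fsupp (fun n => dl n * g n).
  by apply/fsuppMr/fsuppD; apply: fsupp_sqr => //; exact: fsupp_shift.
have blockfs (G : int -> R) : fsupp G -> fsupp (fun k : int => \sum_(0 <= i < L) G (k * L%:Z + i%:Z)).
  move=> [t tG]; exists [seq (n %/ L%:Z)%Z | n <- t] => k kt.
  rewrite big_nat big1 // => i iL; apply: tG; apply: contra kt => h.
  by apply/mapP; exists (k * L%:Z + i%:Z) => //; rewrite divz_block //; case/andP: iL.
have fpsi2 := fsupp_sqr fpsi; have fphi2 := fsupp_sqr fphi.
have cuts : fsum (fun n => dl n * g n) <= kappa * nrm2 psi + C * nrm2 (hop v psi).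
  rewrite (fsum_block L0) // !nrm2_sq (fsum_block L0 fpsi2) (fsum_block L0 fphi2) -!fsumZ.
  have f1 := fsuppMr (fun=> kappa) (blockfs _ fpsi2).
  have f2 := fsuppMr (fun=> C) (blockfs _ fphi2).
  rewrite -fsumD //; apply: fsum_le => [||k]; first exact: (blockfs (fun n => dl n * g n)).
    exact: fsuppD f1 f2.
  apply: le_trans (cut k); have /andP[x1 x2] := xL k.
  have [q qL xq] : exists2 q : nat, (q < L)%N & x k = k * L%:Z + q%:Z.
    by exists `|(x k - k * L%:Z)%R|%N; move: x1 x2; clear; nia.
  rewrite big_mkord (bigD1 (Ordinal qL)) //= -xq [X in _ + X]big1 => [|i iq].
    rewrite addr0 /g [leRHS]addrC -[leRHS]mul1r; apply: ler_wpM2r.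
      by rewrite addr_ge0 ?sqr_ge0.
    by rewrite /dl; case: (_ != _).
  rewrite /dl; case: eqP => [_|/eqP h] /=; first by rewrite mul0r.
  have := piece_cut L0 xL h.
  have -> : ((k * L%:Z + i%:Z) %/ L%:Z)%Z = k by exact: divz_block.
  move=> e; case/eqP: iq; apply: val_inj => /=.
  by move: e; rewrite xq; clear; lia.
have tot : 8 * kappa * nrm2 psi <= fsum (fun k => fsum (F k)).
  rewrite -sum_chi -fsumZ; apply: fsum_le => [||k].
  - apply: fsuppMr; exists r => k kr; rewrite nrm2_sq /fsum fsbig1 // => n _.
    move: kr; rewrite !mem_cat !negb_or => /and3P[h _ _].
    rewrite /chi /restrict_piece; case: eqP => e; last by rewrite mul0r expr0n.
    have [ns|/sP[-> _ _ _]] := boolP (n \in s); last by rewrite mulr0 expr0n.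
    by case/negP: h; rewrite e; apply: map_f.
  - by exists r => k kr; rewrite /fsum fsbig1 // => n _; exact: Fr.
  - apply: le_trans (big k) _; rewrite nrm2_sq; apply: fsum_le => //.
    by apply: fsupp_sqr; exact: fsupp_hop.
rewrite sum_F in tot.
have h1 : (3 + 6 * C) * nrm2 (hop v psi) <= kappa * nrm2 psi.
  apply: le_trans (_ : (3 + 6 * C) * (eta * nrm2 psi) <= _).
    by apply: ler_wpM2l => //; rewrite addr_ge0 // mulr_ge0.
  by rewrite mulrA ler_wpM2r // ltW.
have h2 : 0 < kappa * nrm2 psi by exact: mulr_gt0.
lra.
Qed.

Lemma nrm2_hop_perturb v v' chi d (D : set int) : fsupp chi ->
  (forall n, chi n != 0 -> D n) -> (forall n, D n -> `|v' n - v n| <= d) ->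
  nrm2 (hop v' chi) <= 2 * nrm2 (hop v chi) + 2 * (d ^+ 2 * nrm2 chi).
Proof.
move=> fchi chiD vd.
have -> : hop v' chi = (fun n => hop v chi n + (v' n - v n) * chi n).
  by apply/funext => n; rewrite /hop; ring.
apply: le_trans (nrm2D_le _ _) _; [exact: fsupp_hop | exact: fsuppMr |].
rewrite lerD2l ler_pM2l // !nrm2_sq -fsumZ; apply: fsum_le => [||n].
- by apply: fsupp_sqr; exact: fsuppMr.
- by apply: fsuppMr; exact: fsupp_sqr.
have [->|c0] := eqVneq (chi n) 0; first by rewrite mulr0 expr0n mulr0.
rewrite exprMn ler_wpM2r ?sqr_ge0 // -real_normK ?num_real // lerXn2r ?nnegrE //.
  exact: le_trans (normr_ge0 _) (vd _ (chiD _ c0)).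
exact: vd _ (chiD _ c0).
Qed.

End Pieces.

(** * Transfer matrices as functions of the phase *)

Section PolynomialTransfer.
Variables (R : realType) (f : R -> R) (alpha E : R).

Lemma Ttr_tm theta n : Ttr f alpha n theta E = tm (pot f alpha theta E) 0 n.
Proof.
elim: n => [//|n IH] /=; rewrite IH; congr (_ *m _).
by apply/matrixP => i j; rewrite !mxE /pot add0r -pmulrn opprB.
Qed.

Lemma tm_Ttr (i : int) n : tm (pot f alpha 0 E) i n = Ttr f alpha n (i%:~R * alpha) E.
Proof.
elim: n => [//|n IH] /=; rewrite IH; congr (_ *m _).
apply/matrixP => r s; rewrite !mxE /pot opprB intrD addr0 -pmulrn.
by rewrite (_ : alpha * (i%:~R + n%:R) = alpha * n%:R + i%:~R * alpha) //; ring.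
Qed.

Lemma Ttr_periodic theta n (z : int) : periodic1 f ->
  Ttr f alpha n (theta + z%:~R) E = Ttr f alpha n theta E.
Proof.
move=> pf; elim: n => [//|n IH] /=; rewrite IH; congr (_ *m _).
by apply/matrixP => r s; rewrite !mxE addrA periodic1_int.
Qed.

Lemma det_Ttr theta n : \det (Ttr f alpha n theta E) = 1.
Proof. by rewrite Ttr_tm det_tm. Qed.

Lemma Ttr_norm_gt0 theta n : 0 < `|Ttr f alpha n theta E|.
Proof.
rewrite lt_neqAle normr_ge0 andbT eq_sym normr_eq0; apply/eqP => T0.
by have := det_Ttr theta n; rewrite T0 det2E !mxE mul0r subrr => /eqP; rewrite eq_sym oner_eq0.
Qed.

Variable V : R.
Hypothesis fV : forall x, `|f x - E| <= V.
Let K := 2 * (V + 1).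
Let V0 : 0 <= V. Proof. exact: le_trans (normr_ge0 _) (fV 0). Qed.
Let K1 : 1 <= K. Proof. by rewrite /K; have := V0; lra. Qed.
Let K2 : 1 <= 2 * K. Proof. by rewrite /K; have := V0; lra. Qed.
Let K0 : 0 <= K. Proof. exact: le_trans K1. Qed.

Lemma Ttr_norm theta n : `|Ttr f alpha n theta E| <= K ^+ n.
Proof. by rewrite Ttr_tm; apply: tm_norm => k; exact: fV. Qed.

Lemma Mtr_mulE theta n (A : 'M[R]_2) b :
  (Mtr f alpha n theta E *m A) 0 b = (E - f (alpha * n%:R + theta)) * A 0 b - A 1 b /\
  (Mtr f alpha n theta E *m A) 1 b = A 0 b.
Proof. by rewrite !mulmx2E !mxE /= mulN1r mul1r mul0r addr0. Qed.

(** Every factor is replaced by a local polynomial of precision [2 ^- d], and one multiplication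
    enlarges the error at most by [V + 3 <= 2 K]. Taking [d] proportional to [n] keeps the total
    error below [1]. *)
Lemma Ttr_poly M theta0 d n : (forall x, poly_approx f M x) -> 0 <= M -> M * 2^-1 ^+ d <= 1 ->
  exists P : 'I_2 -> 'I_2 -> {poly R}, (forall a b, (size (P a b) <= n * d.+1 + 1)%N) /\
    forall theta, `|theta - theta0| < M^-1 -> forall a b,
      `|Ttr f alpha n theta E a b - (P a b).[theta]| <= M * 2^-1 ^+ d * (2 * K) ^+ n.
Proof.
move=> fM M0 small; set ep := M * 2^-1 ^+ d in small *.
have ep0 : 0 <= ep by rewrite /ep mulr_ge0 // exprn_ge0.
elim: n => [|n [P [Psz PP]]].
  exists (fun a b => ((a == b)%:R)%:P); split=> [a b|theta _ a b].
    by rewrite mul0n add0n; exact: size_polyC_leq1.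
  by rewrite hornerC mxE subrr normr0 mulr1.
have [p sp pP] := (fM (alpha * n%:R + theta0)).1 d.
pose p' := p \Po ('X + (alpha * n%:R)%:P).
have sp' : (size p' <= d)%N by rewrite size_comp_poly2 // size_XaddC.
pose q := E%:P - p'.
have sq : (size q <= d.+1)%N.
  apply: (leq_trans (size_polyD _ _)); rewrite size_polyN geq_max (leqW sp') andbT.
  by apply: (leq_trans (size_polyC_leq1 _)).
exists (fun a b => if a == 0 then q * P 0 b - P 1 b else P 0 b); split=> [a b|theta th a b].
  have sz c : (size (P c b) <= n.+1 * d.+1 + 1)%N.
    by apply: (leq_trans (Psz c b)); rewrite leq_add2r leq_mul2r leqnSn orbT.
  case: ifP => _ //; apply: (leq_trans (size_polyD _ _)); rewrite size_polyN geq_max sz andbT.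
  apply: (leq_trans (size_polyMleq _ _)).
  by move: sq (Psz 0 b); clear; move: (size q) (size (P 0 b)) => s t; lia.
have IH := PP theta th; set X := (2 * K) ^+ n in IH.
have X0 : 0 <= X by rewrite exprn_ge0 // mulr_ge0.
have [e0 e1] := Mtr_mulE theta n (Ttr f alpha n theta E) b.
case: a => [[|[|//]] a2] /=.
  rewrite (_ : Ordinal a2 = 0) ?eqxx; last exact: val_inj.
  rewrite e0 hornerD hornerM hornerN hornerD hornerC hornerN horner_comp hornerD hornerX hornerC.
  set y := theta + alpha * n%:R; rewrite (_ : alpha * n%:R + theta = y); last by rewrite /y addrC.
  set T0 := Ttr _ _ _ _ _ 0 b; set T1 := Ttr _ _ _ _ _ 1 b.
  set P0 := (P 0 b).[theta]; set P1 := (P 1 b).[theta].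
  have -> : (E - f y) * T0 - T1 - ((E - p.[y]) * P0 - P1) =
    (E - f y) * (T0 - P0) + (p.[y] - f y) * P0 - (T1 - P1) by ring.
  have h1 : `|(E - f y) * (T0 - P0)| <= V * (ep * X).
    by rewrite normrM; apply: ler_pM => //; [rewrite distrC; exact: fV | exact: IH].
  have hp : `|p.[y] - f y| <= ep.
    rewrite distrC; apply: pP; rewrite (_ : y - _ = theta - theta0) //.
      by rewrite /y; ring.
  have hP : `|P0| <= 2 * X.
    have t1 : `|T0| <= X.
      apply: le_trans (mx_entry_le _ _ _) _; apply: le_trans (Ttr_norm _ _) _.
      rewrite /X [(2 * K) ^+ n]exprMn; apply: ler_peMl; first exact: exprn_ge0.
      by apply: exprn_ege1; rewrite ler1n.
    have t2 : `|T0 - P0| <= X by apply: le_trans (IH 0 b) _; rewrite ler_piMl.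
    by have := ler_normB T0 (T0 - P0); rewrite subKr; lra.
  have h2 : `|(p.[y] - f y) * P0| <= ep * (2 * X) by rewrite normrM; exact: ler_pM.
  have h3 : `|T1 - P1| <= ep * X by exact: IH.
  apply: le_trans (ler_normB _ _) _; apply: le_trans (lerD (ler_normD _ _) (lexx _)) _.
  rewrite exprS -/X /K; have : 0 <= ep * X by exact: mulr_ge0.
  have := V0; nra.
rewrite (_ : Ordinal a2 = 1); last exact: val_inj.
rewrite e1 /=; apply: le_trans (IH 0 b) _; apply: ler_wpM2l => //.
by rewrite exprS -/X; apply: ler_peMl.
Qed.

Lemma Ttr_lipschitz L n : (forall x y, `|f x - f y| <= L * `|x - y|) -> 0 <= L ->
  exists2 C, 0 <= C & forall x y, `|Ttr f alpha n x E - Ttr f alpha n y E| <= C * `|x - y|.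
Proof.
move=> fL L0; elim: n => [|n [C C0 CP]].
  by exists 0 => // x y /=; rewrite subrr normr0 mul0r.
exists ((V + 1) * C + C + L * K ^+ n) => [|x y].
  by rewrite !addr_ge0 ?mulr_ge0 ?exprn_ge0 ?addr_ge0.
have Kn t b : `|Ttr f alpha n t E 0 b| <= K ^+ n.
  exact: le_trans (mx_entry_le _ _ _) (Ttr_norm _ _).
have CPe a b : `|Ttr f alpha n x E a b - Ttr f alpha n y E a b| <= C * `|x - y|.
  by have := mx_entry_le (Ttr f alpha n x E - Ttr f alpha n y E) a b; rewrite !mxE => /le_trans; apply.
have mxB (A B : 'M[R]_2) a b : (A - B) a b = A a b - B a b by rewrite !mxE.
apply: mx_norm_le => a b; rewrite /= mxB.
have [x0 x1] := Mtr_mulE x n (Ttr f alpha n x E) b.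
have [y0 y1] := Mtr_mulE y n (Ttr f alpha n y E) b.
have D0 : 0 <= `|x - y| by [].
have LK : 0 <= L * K ^+ n * `|x - y| by rewrite !mulr_ge0 // exprn_ge0.
case: a => [[|[|//]] a2]; last first.
  rewrite (_ : Ordinal a2 = 1) /=; last exact: val_inj.
  rewrite x1 y1; apply: le_trans (CPe 0 b) _; rewrite !mulrDl.
  by have := mulr_ge0 V0 (mulr_ge0 C0 D0); have := mulr_ge0 C0 D0; lra.
rewrite (_ : Ordinal a2 = 0) /=; last exact: val_inj.
rewrite x0 y0; set fx := f _; set fy := f _.
set T := Ttr f alpha n; have -> : (E - fx) * T x E 0 b - T x E 1 b - ((E - fy) * T y E 0 b - T y E 1 b) =
  (E - fx) * (T x E 0 b - T y E 0 b) + (fy - fx) * T y E 0 b - (T x E 1 b - T y E 1 b) by ring.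
have h1 : `|(E - fx) * (T x E 0 b - T y E 0 b)| <= V * (C * `|x - y|).
  rewrite normrM; apply: ler_pM; [by []|by []| |exact: (CPe 0 b)].
  by rewrite distrC; exact: fV.
have h2 : `|(fy - fx) * T y E 0 b| <= L * `|x - y| * K ^+ n.
  rewrite normrM; apply: ler_pM => //.
  rewrite distrC (le_trans (fL _ _)) // /fx.
  by rewrite (_ : alpha * n%:R + x - (alpha * n%:R + y) = x - y) //; ring.
have h3 := CPe 1 b.
apply: le_trans (ler_normB _ _) _; apply: le_trans (lerD (ler_normD _ _) (lexx _)) _.
rewrite -/(T) in h3; have := mulr_ge0 C0 D0; lra.
Qed.

End PolynomialTransfer.

(** * Cells and polynomial roots *)

Section RootCounting.
Variable R : realType.

Definition cell (Q i : nat) : set R := [set x | i%:R / Q%:R <= x < i.+1%:R / Q%:R].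

Lemma cell_disjoint (Q i j : nat) x : (0 < Q)%N -> cell Q i x -> cell Q j x -> i = j.
Proof.
move=> Q0 /andP[i1 i2] /andP[j1 j2].
have lt k l : k%:R / Q%:R <= x -> x < l.+1%:R / Q%:R -> (k <= l)%N.
  by move=> h1 h2; have := le_lt_trans h1 h2; rewrite ltr_pM2r ?invr_gt0 ?ltr0n // ltr_nat.
by apply/eqP; rewrite eqn_leq !lt.
Qed.

Lemma cell_of (Q : nat) x : (0 < Q)%N -> 0 <= x < 1 -> exists2 i : 'I_Q, True & cell Q i x.
Proof.
move=> Q0 /andP[x0 x1]; have Qr : 0 < Q%:R :> R by rewrite ltr0n.
have xQ0 : 0 <= x * Q%:R by rewrite mulr_ge0 // ltW.
have /andP[t1 t2] := truncn_itv xQ0.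
have tQ : (Num.truncn (x * Q%:R) < Q)%N.
  by rewrite -(ltr_nat R) (le_lt_trans t1) // -[ltRHS]mul1r ltr_pM2r.
exists (Ordinal tQ) => //; rewrite /cell /=.
by rewrite ler_pdivrMr // t1 /= ltr_pdivlMr.
Qed.

Lemma card_root_cells (Q D : nat) (q : {poly R}) (S : {set 'I_Q}) : (0 < Q)%N ->
  q != 0 -> (size q <= D.+1)%N ->
  (forall i, i \in S -> exists2 z, cell Q i z & root q z) -> (#|S| <= D)%N.
Proof.
move=> Q0 q0 qD Sz.
have /choice[z zP] : forall i : 'I_Q, exists z, i \in S -> cell Q i z /\ root q z.
  by move=> i; have [/Sz[z h1 h2]|_] := boolP (i \in S); [exists z | exists 0].
have := @max_poly_roots R q [seq z i | i <- enum S] q0.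
rewrite size_map -cardE => h; rewrite -ltnS; apply: leq_trans qD; apply: h.
  by apply/allP => y /mapP[i iS ->]; move: iS; rewrite mem_enum => /zP[].
rewrite map_inj_in_uniq ?enum_uniq // => i j; rewrite !mem_enum => /zP[ci _] /zP[cj _] e.
by apply: val_inj; apply: (cell_disjoint Q0 ci); rewrite e.
Qed.

Lemma card_cover (I : finType) (J : finType) (S : {set I}) (F : J -> {set I}) (D : nat) :
  (forall i, i \in S -> exists j, i \in F j) -> (forall j, (#|F j| <= D)%N) ->
  (#|S| <= #|J| * D)%N.
Proof.
move=> SF FD; have : S \subset (\bigcup_j F j)%SET.
  by apply/fintype.subsetP => i /SF[j ij]; apply/finset.bigcupP; exists j.
move=> /subset_leq_card /leq_trans; apply.
have : (#|(\bigcup_j F j)%SET| <= \sum_j #|F j|)%N.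
  elim/big_rec2: _ => [|j n A _ IH]; first by rewrite cards0.
  by apply: leq_trans (leq_card_setU _ _) _; rewrite leq_add2l.
move=> /leq_trans; apply; apply: (@leq_trans (\sum_(j : J) D)%N); last by rewrite sum_nat_const.
by apply: leq_sum => j _.
Qed.

End RootCounting.

(** * Cells on which the transfer matrix is large *)

Section Growth.
Variable R : realType.
Notation mu := (@lebesgue_measure R).

Lemma Rintegral_bad_cells (F : R -> R) (Q : nat) (Bad : pred nat) (c B : R) : (0 < Q)%N ->
  {within `[0%R, 1%R], continuous F} -> 0 <= B -> 0 <= c -> (forall x, F x <= B) ->
  (forall (i : nat) x, (i < Q)%N -> ~~ Bad i -> cell Q i x -> F x <= c) ->
  Rintegral mu `[0%R, 1%R] F <= c + B * ((\sum_(i < Q) Bad i)%N%:R / Q%:R).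
Proof.
move=> Q0 cF B0 c0 FB Fc.
have Qr : 0 < Q%:R :> R by rewrite ltr0n.
(* The additional index [Q] accounts for the endpoint [1], which lies in none of the [Q] cells. *)
pose G (k : nat) : set R := if (k < Q)%N then (if Bad k then `[k%:R / Q%:R, k.+1%:R / Q%:R[%classic else set0)
  else [set 1].
have mG k : measurable (G k).
  by rewrite /G; case: ifP => _; [case: ifP => _ |].
pose W := \big[setU/set0]_(k < Q.+1) G k.
have mW : measurable W by apply: bigsetU_measurable.
have muG (k : nat) : (k < Q)%N -> mu (G k) = ((Bad k)%:R / Q%:R)%:E.
  move=> kQ; rewrite /G kQ; case: (Bad k); last by rewrite measure0 mul0r.
  rewrite lebesgue_measure_itv /= lte_fin ltr_pM2r ?invr_gt0 // ltr_nat leqnn -EFinB.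
  by rewrite -mulrBl -natrB // subSnn.
have muW : (mu W <= ((\sum_(i < Q) Bad i)%N%:R / Q%:R)%:E)%E.
  have h : (mu W <= \sum_(k < Q.+1) mu (G k))%E by apply: content_subadditive => // [k _]; exact: mG.
  apply: le_trans h _.
  rewrite big_ord_recr /= [X in (_ + X)%E](_ : _ = 0%E); last by rewrite /G ltnn lebesgue_measure_set1.
  rewrite adde0 (eq_bigr (fun i : 'I_Q => ((Bad i)%:R / Q%:R)%:E)); last by move=> i _; exact: muG.
  by rewrite sumEFin lee_fin -mulr_suml natr_sum.
have mI : measurable (`[0%R, 1%R] : set R) by [].
have muI : mu `[0%R, 1%R] = 1%E by rewrite lebesgue_measure_itv /= lte_fin ltr01 -EFinB subr0.
have muf : (mu `[0%R, 1%R] < +oo)%E by rewrite muI ltry.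
have iF : mu.-integrable `[0%R, 1%R] (EFin \o F).
  by apply: continuous_compact_integrable => //; exact: segment_compact.
have i1 : mu.-integrable `[0%R, 1%R] (EFin \o cst c).
  apply: measurable_bounded_integrable => //.
  by exists `|c|; split; [exact: num_real | move=> x cx y _ /=; exact: ltW].
have i2' : mu.-integrable `[0%R, 1%R] (EFin \o (\1_W : R -> R)).
  apply: measurable_bounded_integrable => //.
  exists 1; split; first exact: num_real.
  by move=> x x1 y _ /=; rewrite indicE; case: (_ \in _); rewrite ?normr1 ?normr0; lra.
have bd (d x : R) : 0 <= d -> `|d + B * \1_W x| <= d + B.
  move=> d0; rewrite indicE; case: (_ \in _); rewrite ?mulr1 ?mulr0 ?addr0 ger0_norm ?lerDl //.
  exact: addr_ge0.
have id d : 0 <= d -> mu.-integrable `[0%R, 1%R] (EFin \o (fun x => d + B * \1_W x)).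
  move=> d0; apply: measurable_bounded_integrable => //.
    by apply: measurable_realfun.measurable_funD => //; exact: measurable_realfun.measurable_funM.
  by exists (d + B); split=> [|x xb y _ /=]; [exact: num_real | apply: le_trans (bd _ _ d0) (ltW xb)].
have i3 := id _ c0.
have i2 : mu.-integrable `[0%R, 1%R] (EFin \o (fun x => B * \1_W x)).
  have := id 0 (lexx 0); congr (_.-integrable _ (EFin \o _)).
  by apply/funext => x; rewrite add0r.
apply: le_trans (_ : Rintegral mu `[0%R, 1%R] (fun x => c + B * \1_W x) <= _).
  apply: le_Rintegral => // x /=; rewrite in_itv /= => /andP[x0 x1].
  rewrite indicE; case: (boolP (x \in W)) => xW.
    by rewrite mulr1; apply: le_trans (FB x) _; rewrite lerDr.
  rewrite mulr0 addr0.
  have nW (k : nat) : (k < Q.+1)%N -> ~ G k x.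
    move=> kQ Gk; move/negP: xW; apply; rewrite inE /W.
    by rewrite -bigcup_mkord; exists k.
  have xn1 : x < 1.
    rewrite lt_neqAle x1 andbT; apply/eqP => xe; apply: (nW Q) => //.
    by rewrite /G ltnn.
  have [|i _ ci] := @cell_of R Q x Q0; first by rewrite x0.
  apply: (Fc i x) => //; apply/negP => bi; apply: (nW i); first exact: leqW (ltn_ord i).
  by rewrite /G ltn_ord bi /= in_itv.
rewrite RintegralD // Rintegral_cst // [X in c * X](_ : _ = 1); last first.
  by rewrite -[RHS]/(fine 1%E); congr fine; exact: muI.
rewrite mulr1 lerD2l RintegralZl //.
apply: ler_wpM2l => //; rewrite /Rintegral integral_indic //.
have mWI : (mu (W `&` `[0%R, 1%R]) <= ((\sum_(i < Q) Bad i)%N%:R / Q%:R)%:E)%E.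
  by apply: le_trans muW; apply: le_measure; rewrite ?inE //; exact: measurableI.
rewrite -lee_fin fineK // ge0_fin_numE ?measure_ge0 //.
exact: le_lt_trans mWI (ltry _).
Qed.

Variables (f : R -> R) (alpha E V : R).
Hypothesis fV : forall x, `|f x - E| <= V.
Let K := 2 * (V + 1).

(** The gap [2] between the two levels absorbs an approximation error of [1] at either point, so for
    some entry [P ^ 2 - (lam + 1) ^ 2] changes sign in the cell. The bound counts [R0] intervals of
    approximation, [4] entries and the degree. *)
Lemma card_bad_cells (M lam : R) (n d Q R0 : nat) (S : {set 'I_Q}) : 0 < M ->
  (forall x, poly_approx f M x) -> M * 2^-1 ^+ d <= 1 -> M * 2^-1 ^+ d * (2 * K) ^+ n <= 1 ->
  2 * M < R0%:R -> (R0 <= Q)%N -> 0 <= lam ->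
  (forall i : 'I_Q, exists2 x, cell Q i x & `|Ttr f alpha n x E| <= lam) ->
  (forall i, i \in S -> exists2 x, cell Q i x & lam + 2 < `|Ttr f alpha n x E|) ->
  (#|S| <= R0 * 4 * (2 * (n * d.+1)))%N.
Proof.
move=> M0 fM small1 small2 MR RQ lam0 good bad.
have R00 : (0 < R0)%N by rewrite -(ltr_nat R) (lt_trans _ MR) // mulr_gt0.
have Q0 : (0 < Q)%N by exact: leq_trans RQ.
have R0r : 0 < R0%:R :> R by rewrite ltr0n.
have Qr : 0 < Q%:R :> R by rewrite ltr0n.
have /choice[P PP] := fun t : 'I_R0 =>
  Ttr_poly alpha fV (t%:R / R0%:R) n fM (ltW M0) small1.
pose q (j : 'I_R0 * ('I_2 * 'I_2)) := P j.1 j.2.1 j.2.2 ^+ 2 - ((lam + 1) ^+ 2)%:P.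
pose F j : {set 'I_Q} := [set i : 'I_Q | (q j != 0) && `[< exists2 z, cell Q i z & root (q j) z >]]%SET.
have sq j : (size (q j) <= (2 * (n * d.+1)).+1)%N.
  rewrite /q; apply: (leq_trans (size_polyD _ _)); rewrite size_polyN geq_max.
  rewrite (leq_trans (size_polyC_leq1 _)) // andbT.
  apply: (leq_trans (size_polyMleq _ _)).
  have := (PP j.1).1 j.2.1 j.2.2; clear; move: (size _) (n * _)%N => s t; lia.
have cF j : (#|F j| <= 2 * (n * d.+1))%N.
  have [q0|q0] := eqVneq (q j) 0.
    by rewrite (_ : F j = finset.set0) ?cards0 //; apply/setP => i; rewrite !inE q0 eqxx.
  apply: (card_root_cells Q0 q0 (sq j)) => i; rewrite inE => /andP[_ /asboolP].
  by [].
have := @card_cover _ _ S F (2 * (n * d.+1)); rewrite card_prod !card_ord card_prod !card_ord.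
apply=> // i iS.
(* The node [t / R0] lies at or before the start of cell [i], and the cell ends before
   [(t + 2) / R0]; [2 M < R0] puts the whole cell within the radius of approximation. *)
have tR : ((i * R0) %/ Q < R0)%N by rewrite ltn_divLR // mulnC ltn_pmul2l.
pose t := Ordinal tR.
have near x : cell Q i x -> `|x - t%:R / R0%:R| < M^-1.
  move=> /andP[x1 x2].
  have h1 : t%:R / R0%:R <= i%:R / Q%:R :> R.
    by rewrite ler_pdivrMr // mulrAC ler_pdivlMr // -!natrM ler_nat leq_divM.
  have h2 : i%:R / Q%:R < t.+1%:R / R0%:R :> R.
    by rewrite ltr_pdivrMr // mulrAC ltr_pdivlMr // -!natrM ltr_nat ltn_ceil.
  have h3 : Q%:R^-1 <= R0%:R^-1 :> R by rewrite lef_pV2 ?posrE // ler_nat.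
  have h4 : 2 * R0%:R^-1 < M^-1.
    by rewrite ltr_pdivrMr // -ltr_pdivrMl ?invr_gt0 // invrK mulrC.
  rewrite -!natr1 !mulrDl !mul1r in x2 h2.
  by rewrite ltr_norml; lra.
have [c ci cl] := good i; have [x xi xl] := bad _ iS.
have Tx0 : `|Ttr f alpha n x E| != 0 by rewrite gt_eqF // Ttr_norm_gt0.
have [[a b] /= Tab] := mx_norm_neq0 Tx0.
have {}Tab : `|Ttr f alpha n x E| = `|Ttr f alpha n x E a b| by exact: Tab.
rewrite Tab in xl.
pose j := (t, (a, b)).
have Pc : `|(P t a b).[c]| <= lam + 1.
  have h := le_trans ((PP t).2 c (near c ci) a b) small2.
  have := le_trans (mx_entry_le (Ttr f alpha n c E) a b) cl.
  have := ler_normB (Ttr f alpha n c E a b) (Ttr f alpha n c E a b - (P t a b).[c]).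
  by rewrite subKr; lra.
have Px : lam + 1 < `|(P t a b).[x]|.
  have h := le_trans ((PP t).2 x (near x xi) a b) small2.
  have := ler_normD (P t a b).[x] (Ttr f alpha n x E a b - (P t a b).[x]).
  by rewrite [(P t a b).[x] + _]addrC subrK; lra.
have qE y : (q j).[y] = (P t a b).[y] ^+ 2 - (lam + 1) ^+ 2.
  by rewrite /q /= hornerD hornerN hornerC horner_exp.
have lam1 : 0 <= lam + 1 by rewrite addr_ge0.
have qc : (q j).[c] <= 0.
  by rewrite qE subr_le0 -real_normK ?num_real // lerXn2r.
have qx : 0 < (q j).[x].
  by rewrite qE subr_gt0 -[ltRHS]real_normK ?num_real // ltrXn2r.
have q0 : q j != 0 by apply/eqP => e; move: qx; rewrite e horner0 ltxx.
exists j; rewrite inE q0; apply/asboolP.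
have conv z : Num.min c x <= z <= Num.max c x -> cell Q i z.
  move: ci xi => /andP[c1 c2] /andP[x1 x2] /andP[z1 z2]; apply/andP; split.
    by apply: le_trans z1; rewrite le_min c1.
  by apply: le_lt_trans z2 _; rewrite gt_max c2.
have [cx|xc] := leP c x.
  have [|z zcx rz] := @poly_ivt R (q j) c x cx; first by rewrite qc ltW.
  by exists z => //; apply: conv; rewrite min_l // max_r.
have [|z zcx rz] := @poly_ivt R (- q j) x c (ltW xc).
  by rewrite !hornerN oppr_le0 oppr_ge0 qc (ltW qx).
exists z; last by rewrite -rootN.
by apply: conv; rewrite (min_r (ltW xc)) (max_l (ltW xc)).
Qed.

End Growth.

(** * From a positive Lyapunov exponent to growth along orbits *)

Section LyapunovGrowth.
Variable R : realType.
Notation mu := (@lebesgue_measure R).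

Lemma Ttr_norm_continuous (f : R -> R) (alpha E V L : R) n :
  (forall x, `|f x - E| <= V) -> 0 <= L -> (forall x y, `|f x - f y| <= L * `|x - y|) ->
  continuous (fun x => `|Ttr f alpha n x E|).
Proof.
move=> fV L0 fL x; have [C C0 CP] := Ttr_lipschitz alpha fV n fL L0.
apply/cvgrPdist_lt => e e0; have C1 : 0 < C + 1 by rewrite ltr_wpDl.
exists (e / (C + 1)) => /=; first exact: divr_gt0.
move=> y /= xy; apply: le_lt_trans (ler_dist_dist _ _) _; apply: le_lt_trans (CP _ _) _.
apply: le_lt_trans (_ : (C + 1) * `|x - y| < _); first by rewrite ler_wpM2r // lerDl.
by rewrite mulrC -ltr_pdivlMr.
Qed.

Lemma expR_add2_le (x : R) : 0 <= x -> expR x + 2 <= expR (x + 2).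
Proof.
move=> x0; rewrite expRD; have := expR_ge1Dx (2 : R); have := expR_ge1Dx x; nra.
Qed.

(** If [T_n] were at most [lam] along the whole segment, density would put such a phase into every
    cell. Few cells could then contain values above [lam + 2], and the mean of [ln |T_n|] would fall
    below [n] times half the Lyapunov exponent. *)
Lemma orbit_growth (f : R -> R) (alpha E : R) :
  real_analytic f -> periodic1 f -> Omega alpha -> lyap_pos f alpha E ->
  exists2 m : nat, (0 < m)%N & forall n, (m <= n)%N -> forall j : int, exists2 x : nat,
    (x < m * n ^ 2)%N & expR (n%:R / m%:R) < `|Ttr f alpha n ((j + x%:Z)%:~R * alpha) E|.
Proof.
move=> af pf Om [Lp Lp0 cvL].
have [M M0 MP] := analytic_periodic_uniform af pf.
have [L L0 [fL lip]] := analytic_bounded_lipschitz af pf.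
have [C dens] := orbit_density Om.
pose V := L + `|E|.
have fV x : `|f x - E| <= V by apply: le_trans (ler_normB _ _) _; rewrite lerD2r.
have V0 : 0 <= V by exact: le_trans (fV 0).
pose K := 2 * (V + 1); have K1 : 1 <= K by rewrite /K; lra.
have lnK : 0 <= ln K by exact: ln_ge0.
pose l := Lp / 2; have l0 : 0 < l by rewrite divr_gt0.
have [n0 _ lyap] : \forall n \near \oo, l < lyap_seq f alpha E n.
  by apply: cvgr_gt cvL _ _; rewrite /l; lra.
pose up (x : R) := (Num.truncn x).+1.
have upP x : x < (up x)%:R by exact: truncnS_gt.
pose R0 := up (2 * M); pose a1 := up (2 * K); pose a2 := up M.
(* [c4 * n ^ 2] bounds the number of bad cells, and [c5] makes their total length times [ln K] at
   most [l / 4]. The summands of [m] ensure [n >= n0], an orbit long enough for [Q = c5 * n ^ 2]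
   cells, and [n / m + 2 <= (3/16) n l]. *)
pose c4 := (R0 * 4 * (2 * (a1 + a2 + 1)))%N.
pose c5 := (R0 + up (4 * c4%:R * ln K / l))%N.
pose m := (n0 + C * c5 + up (16 / l) + 1)%N.
have m0 : (0 < m)%N by rewrite /m addn1.
exists m => // n mn j; apply: contrapT => none.
have n_gt0 : (0 < n)%N by exact: leq_trans mn.
pose lam := expR (n%:R / m%:R : R).
have small x : (x < m * n ^ 2)%N -> `|Ttr f alpha n ((j + x%:Z)%:~R * alpha) E| <= lam.
  by move=> xm; rewrite leNgt; apply/negP => h; apply: none; exists x.
have c50 : (0 < c5)%N by rewrite /c5 addn_gt0.
pose Q := (c5 * n ^ 2)%N.
have Q0 : (0 < Q)%N by rewrite muln_gt0 c50 expn_gt0 n_gt0.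
have [q qC densQ] := dens Q Q0.
have qm : (q <= m * n ^ 2)%N.
  apply: leq_trans qC _; rewrite /Q mulnA leq_mul2r; apply/orP; right.
  by rewrite /m; clear; lia.
have good (i : 'I_Q) : exists2 x, cell Q i x & `|Ttr f alpha n x E| <= lam.
  have [x xq [z xz]] := densQ j i.
  exists ((j + x%:Z)%:~R * alpha - z%:~R) => //.
  by rewrite -mulrNz Ttr_periodic // small // (leq_trans xq).
pose S : {set 'I_Q} := [set i : 'I_Q | `[< exists2 x, cell Q i x & lam + 2 < `|Ttr f alpha n x E| >]]%SET.
(* [a2] compensates the factor [M], and [a1] compensates [2 K] in each of the [n] steps. *)
pose d := (a1 * n + a2)%N.
have pow2 (x : R) a : x <= a%:R -> x * 2^-1 ^+ a <= 1.
  move=> xa; rewrite exprVn ler_pdivrMr ?exprn_gt0 // mul1r (le_trans xa) // -natrX ler_nat.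
  by rewrite ltnW // ltn_expl.
have Ma2 : M * 2^-1 ^+ a2 <= 1 by apply: pow2; exact: ltW.
have p0 k : 0 <= 2^-1 ^+ k :> R by exact: exprn_ge0.
have p1 k : 2^-1 ^+ k <= 1 :> R by apply: exprn_ile1; rewrite ?invr_ge0 // invf_le1 // ler1n.
have small1 : M * 2^-1 ^+ d <= 1.
  by rewrite /d addnC exprD mulrA; apply: mulr_ile1 => //; apply: mulr_ge0 => //; exact: ltW.
have small2 : M * 2^-1 ^+ d * (2 * K) ^+ n <= 1.
  rewrite /d addnC exprD mulrA exprM -mulrA -exprMn; apply: mulr_ile1 => //.
  - by apply: mulr_ge0 => //; exact: ltW.
  - by apply: exprn_ge0; apply: mulr_ge0 => //; apply: mulr_ge0 => //; exact: le_trans K1.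
  apply: exprn_ile1; first by apply: mulr_ge0 => //; apply: mulr_ge0 => //; exact: le_trans K1.
  by rewrite mulrC; apply: pow2; exact: ltW.
have cardS : (#|S| <= c4 * n ^ 2)%N.
  apply: leq_trans (card_bad_cells (d := d) fV M0 MP small1 small2 (upP _) _ (expR_ge0 _) good _) _.
  - by rewrite /Q /c5 mulnDl -/R0; apply: leq_trans (leq_addr _ _); rewrite leq_pmulr // expn_gt0 n_gt0.
  - by move=> i; rewrite inE => /asboolP.
  have h : (n * d.+1 <= (a1 + a2 + 1) * n ^ 2)%N.
    rewrite /d expnS expn1; move: n_gt0; clear; move: a1 a2 => a b; nia.
  by apply: leq_trans (leq_mul (leqnn _) (leq_mul (leqnn 2) h)) _; rewrite /c4 -/R0 !mulnA.
pose F x := ln `|Ttr f alpha n x E|.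
pose Bad (k : nat) := if insub k is Some i then (i : 'I_Q) \in S else false.
have BadE (i : 'I_Q) : Bad i = (i \in S) by rewrite /Bad valK.
have sumBad : (\sum_(i < Q) Bad i)%N = #|S|.
  by rewrite -sum1_card [RHS]big_mkcond; apply: eq_bigr => i _; rewrite BadE; case: (_ \in _).
have T0 x := Ttr_norm_gt0 f alpha E x n.
have FB x : F x <= n%:R * ln K.
  rewrite mulr_natl -lnXn ?(lt_le_trans _ K1) // ler_ln ?posrE ?T0 ?exprn_gt0 ?(lt_le_trans _ K1) //.
  exact: Ttr_norm.
have lam2 : 0 <= n%:R / m%:R + 2 :> R by rewrite addr_ge0 // divr_ge0.
have Fc (i : nat) x : (i < Q)%N -> ~~ Bad i -> cell Q i x -> F x <= n%:R / m%:R + 2.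
  move=> iQ; rewrite (BadE (Ordinal iQ)) inE => /asboolP h ci.
  rewrite -[leRHS]expRK ler_ln ?posrE ?expR_gt0 //; apply: le_trans (expR_add2_le _); last exact: divr_ge0.
  by rewrite leNgt; apply/negP => lt; apply: h; exists x.
have cF : {within `[0%R, 1%R], continuous F}.
  apply: continuous_subspaceT => x.
  have ct := @Ttr_norm_continuous f alpha E V L n fV (ltW L0) lip x.
  exact: (continuous_comp ct (continuous_ln (T0 x))).
have := Rintegral_bad_cells Q0 cF (mulr_ge0 (ler0n R n) lnK) lam2 FB Fc.
have /lyap : (n0 <= n)%N by apply: leq_trans mn; rewrite /m -!addnA leq_addr.
rewrite /= /lyap_seq -/F sumBad mulrC ltr_pdivlMr ?ltr0n // => h1 h2.
have {h1 h2} h := lt_le_trans h1 h2.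
have nr : 0 < n%:R :> R by rewrite ltr0n.
have mr : 0 < m%:R :> R by rewrite ltr0n.
have ratio : #|S|%:R / Q%:R <= c4%:R / c5%:R :> R.
  rewrite ler_pdivrMr ?ltr0n // mulrAC ler_pdivlMr ?ltr0n // -!natrM ler_nat /Q.
  by rewrite mulnC -[X in (_ <= X)%N]mulnCA mulnC mulnA [(c5 * c4)%N]mulnC mulnAC leq_mul2r cardS orbT.
have c5l : c4%:R / c5%:R * ln K <= l / 4.
  rewrite mulrAC ler_pdivrMr ?ltr0n // [l / 4]mulrC -mulrA -ler_pdivrMl ?invr_gt0 // invrK.
  rewrite mulrC [l * _]mulrC -ler_pdivrMr //.
  have := ltW (upP (4 * c4%:R * ln K / l)); rewrite [_ * 4]mulrC mulrA => /le_trans; apply.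
  by rewrite /c5 ler_nat leq_addl.
have m16 : 16 / l <= m%:R.
  by apply: le_trans (ltW (upP _)) _; rewrite ler_nat /m; clear; lia.
have nm : n%:R / m%:R <= n%:R * (l / 16).
  by rewrite ler_pM2l // -[l / 16]invrK lef_pV2 ?posrE ?invr_gt0 ?divr_gt0 // invf_div.
have n16 : 16 <= n%:R * l.
  by rewrite -ler_pdivrMr //; apply: le_trans m16 _; rewrite ler_nat.
have h3 : n%:R * ln K * (#|S|%:R / Q%:R) <= n%:R * (l / 4).
  rewrite -mulrA ler_pM2l //; apply: le_trans c5l; rewrite mulrC; exact: ler_wpM2r.
lra.
Qed.

End LyapunovGrowth.

(** * Measurability of the spectrum and the exceptional set *)

Section SpectrumSet.
Variable R : realType.
Notation mu := (@lebesgue_measure R).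

Definition approx_eigenvalue (f : R -> R) (alpha E : R) : Prop :=
  forall eta, 0 < eta -> exists psi, [/\ fsupp psi, 0 < nrm2 psi &
    nrm2 (hop (pot f alpha 0 E) psi) < eta * nrm2 psi].

Lemma not_bounded_below v (eta : R) : ~ bounded_below v eta ->
  exists psi, [/\ fsupp psi, 0 < nrm2 psi & nrm2 (hop v psi) < eta * nrm2 psi].
Proof.
move=> /existsNP[psi /not_implyP[fpsi /negP]]; rewrite -ltNge => lt.
exists psi; split=> //; rewrite lt_neqAle nrm2_ge0 andbT; apply/eqP => z.
by move: lt; rewrite -z mulr0 ltNge nrm2_ge0.
Qed.

Variables (f : R -> R) (alpha L : R).
Hypothesis fL : forall x, `|f x| <= L.
Hypothesis lip : forall x y, `|f x - f y| <= L * `|x - y|.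
Hypothesis pf : periodic1 f.
Hypothesis Om : Omega alpha.

Let L0 : 0 <= L. Proof. exact: le_trans (normr_ge0 _) (fL 0). Qed.

Lemma orbit_approx (theta : R) (e : R) : 0 < e ->
  exists (j : nat) (z : int), `|j%:R * alpha - z%:~R - theta| < e.
Proof.
move=> e0; have [C dens] := orbit_density Om.
pose Q := (Num.truncn e^-1).+1.
have Qe : Q%:R^-1 < e.
  rewrite -[ltRHS]invrK ltf_pV2 ?posrE ?invr_gt0 ?ltr0n //; exact: truncnS_gt.
have [q _ densQ] := dens Q isT.
have [i _ /andP[i1 i2]] := cell_of (Q := Q) isT (fracpart_itv theta).
have [j _ [z /andP[z1 z2]]] := densQ 0 i.
exists j, (z - Num.floor theta); rewrite add0r in z1 z2.
rewrite (_ : _ - theta = j%:R * alpha - z%:~R - fracpart theta); last first.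
  by rewrite /fracpart intrB; ring.
rewrite -[j%:R]/(j%:Z%:~R); rewrite -natr1 mulrDl mul1r in i2 z2.
by rewrite ltr_norml; apply/andP; split; lra.
Qed.

(** A test vector for phase [theta], translated by [j] with [j alpha] close to [theta] modulo [1],
    becomes a test vector for phase [0]. So the union over [theta] is already the spectrum at
    [0]. *)
Lemma spec_union_approx E : spec_union f alpha E <-> approx_eigenvalue f alpha E.
Proof.
split=> [[theta nres] eta eta0|app]; last first.
  exists 0 => /resolvent_bounded_below[eta eta0 low].
  by have [psi [fpsi psi0]] := app _ eta0; rewrite ltNge low.
have e40 : 0 < eta / 4 by rewrite divr_gt0.
have [|x [fx x0 xs]] := @not_bounded_below (pot f alpha theta E) (eta / 4).
  by move=> low; apply: nres; exact: bounded_below_resolvent low.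
pose s := Num.sqrt (eta / 4); have s0 : 0 < s by rewrite sqrtr_gt0.
have L1 : 0 < L + 1 by rewrite ltr_wpDl.
have [j [z jz]] := orbit_approx theta (divr_gt0 s0 L1).
exists (fun n => x (n - j%:Z)); split; first exact: fsupp_shift.
  by rewrite (nrm2_shift x (- j%:Z)).
pose v' n := pot f alpha 0 E (n + j%:Z).
have -> : hop (pot f alpha 0 E) (fun n => x (n - j%:Z)) = (fun n => hop v' x (n - j%:Z)).
  apply/funext => n; rewrite /hop /v' subrK.
  by congr (x _ + x _ + _); ring.
rewrite (nrm2_shift (hop v' x) (- j%:Z)) (nrm2_shift x (- j%:Z)).
apply: le_lt_trans (_ : _ <= 2 * nrm2 (hop (pot f alpha theta E) x) + 2 * (s ^+ 2 * nrm2 x)) _.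
  apply: (nrm2_hop_perturb (D := setT)) => // n _; rewrite /v' /pot addr0 opprB addrA subrK.
  rewrite -(periodic1_int (- z) (alpha * (n + j%:Z)%:~R) pf).
  apply: le_trans (lip _ _) _.
  rewrite (_ : _ - (alpha * n%:~R + theta) = j%:R * alpha - z%:~R - theta); last first.
    by rewrite intrD mulrNz -[j%:R]/(j%:Z%:~R); ring.
  apply: le_trans (ler_wpM2l L0 (ltW jz)) _.
  rewrite mulrA ler_pdivrMr // mulrC ler_pM2l // lerDl ler01 //.
rewrite sqr_sqrtr ?(ltW e40) //; lra.
Qed.

(** Comparing [h] at energies [0] and [E] gives [E ^ 2 <= 2 (8 + 2 L ^ 2) + 2]; as the right side is
    at least [1], it bounds [|E|] too. *)
Lemma approx_eigenvalue_bounded E : approx_eigenvalue f alpha E -> `|E| <= 18 + 4 * L ^+ 2.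
Proof.
move=> /(_ 1 ltr01)[psi [fpsi psi0 small]].
have h1 : nrm2 (hop (pot f alpha 0 0) psi) <= (8 + 2 * L ^+ 2) * nrm2 psi.
  by apply: nrm2_hop_le => // n; rewrite /pot subr0.
have fh v : fsupp (hop v psi) by exact: fsupp_hop.
have := nrm2D_le (fh (pot f alpha 0 0)) (fsuppMr (fun=> -1) (fh (pot f alpha 0 E))).
have eqf : (fun n => hop (pot f alpha 0 0) psi n + -1 * hop (pot f alpha 0 E) psi n) =
    (fun n => E * psi n).
  by apply/funext => n; rewrite /hop /pot; ring.
rewrite eqf !nrm2Z sqrrN expr1n mul1r => h2.
have : E ^+ 2 * nrm2 psi <= (18 + 4 * L ^+ 2) * nrm2 psi.
  by rewrite mul1r in small; lra.
rewrite ler_pM2r // => h3; have L2 := sqr_ge0 L.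
rewrite -(ler_pXn2r (n := 2)) ?nnegrE //; last by lra.
by rewrite real_normK ?num_real //; nra.
Qed.

Lemma nrm2_hop_open (psi : int -> R) c : fsupp psi ->
  open [set E | nrm2 (hop (pot f alpha 0 E) psi) < c].
Proof.
move=> fpsi; pose h0 := hop (pot f alpha 0 0) psi.
have fh0 : fsupp h0 by exact: fsupp_hop.
have e E : nrm2 (hop (pot f alpha 0 E) psi) =
   nrm2 h0 + E * (- 2 * dotp h0 psi) + E * E * nrm2 psi.
  have -> : hop (pot f alpha 0 E) psi = (fun n => h0 n + (- E) * psi n).
    by apply/funext => n; rewrite /h0 /hop /pot; ring.
  have fE : fsupp (fun n => (- E) * psi n) by exact: fsuppMr.
  clearbody h0.
  rewrite /nrm2 dotpDl; last exact: fsuppD.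
  by rewrite dotpZl !dotpDr // !dotpZr [dotp psi h0]dotpC; ring.
have -> : [set E | nrm2 (hop (pot f alpha 0 E) psi) < c] =
   (fun E => nrm2 h0 + E * (- 2 * dotp h0 psi) + E * E * nrm2 psi) @^-1` [set y | y < c].
  by apply/seteqP; split=> E /=; rewrite e.
apply: open_comp; last exact: open_lt.
move=> E _; apply: cvgD.
  apply: cvgD; first exact: cvg_cst.
  by apply: cvgM; [exact: cvg_id | exact: cvg_cst].
by apply: cvgM; [apply: cvgM; exact: cvg_id | exact: cvg_cst].
Qed.

(** A countable intersection of open sets: the union over the uncountable family of [psi] remains
    open. *)
Lemma spec_union_measurable : measurable (spec_union f alpha : set R).
Proof.
have -> : spec_union f alpha = \bigcap_(k : nat) \bigcup_(psi in [set psi | fsupp psi /\ 0 < nrm2 psi])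
    [set E | nrm2 (hop (pot f alpha 0 E) psi) < k.+1%:R^-1 * nrm2 psi].
  apply/seteqP; split=> E.
    move=> /spec_union_approx app k _.
    have [|psi [fpsi psi0 small]] := app k.+1%:R^-1; first by rewrite invr_gt0 ltr0n.
    by exists psi.
  move=> h; apply/spec_union_approx => eta eta0.
  have [psi [fpsi psi0] /= small] := h (Num.truncn eta^-1) I.
  exists psi; split=> //; apply: lt_le_trans small _; rewrite ler_pM2r //.
  rewrite -[leRHS]invrK lef_pV2 ?posrE ?invr_gt0 ?ltr0n //.
  by apply: ltW; exact: truncnS_gt.
apply: bigcapT_measurable => k; apply: measurable_realfun.open_measurable; apply: bigcup_open => psi [fpsi _].
exact: nrm2_hop_open.
Qed.

(** The constant of [orbit_growth] is frozen at [m.+1]; making it uniform in [E] is the purpose of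
    the exceptional set. *)
Definition growth_set (m : nat) : set R :=
  [set E | forall n, (m.+1 <= n)%N -> forall j : int, exists2 x : nat, (x < m.+1 * n ^ 2)%N &
     expR (n%:R / m.+1%:R) < `|Ttr f alpha n ((j + x%:Z)%:~R * alpha) E|].

Lemma Ttr_open n theta c : open [set E | c < `|Ttr f alpha n theta E|].
Proof.
have ct : forall a b, continuous (fun E => Ttr f alpha n theta E a b).
  elim: n => [|n IH] a b.
    by move=> E; exact: cvg_cst.
  move=> E; case: a => [[|[|//]] a2].
    have -> : (fun E => Ttr f alpha n.+1 theta E (Ordinal a2) b) = (fun E =>
        (E - f (alpha * n%:R + theta)) * Ttr f alpha n theta E 0 b - Ttr f alpha n theta E 1 b).
      apply/funext => E'; rewrite (_ : Ordinal a2 = 0); last exact: val_inj.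
      by rewrite -(Mtr_mulE f alpha E' theta n (Ttr f alpha n theta E') b).1.
    apply: cvgB; last exact: IH.
    by apply: cvgM; [apply: cvgB; [exact: cvg_id | exact: cvg_cst] | exact: IH].
  have -> : (fun E => Ttr f alpha n.+1 theta E (Ordinal a2) b) = (fun E => Ttr f alpha n theta E 0 b).
    apply/funext => E'; rewrite (_ : Ordinal a2 = 1); last exact: val_inj.
    by rewrite -(Mtr_mulE f alpha E' theta n (Ttr f alpha n theta E') b).2.
  exact: IH.
have -> : [set E | c < `|Ttr f alpha n theta E|] =
   \bigcup_(ab in [set: 'I_2 * 'I_2]) [set E | c < `|Ttr f alpha n theta E ab.1 ab.2|].
  apply/seteqP; split=> E /=.
    have T0 : `|Ttr f alpha n theta E| != 0 by rewrite gt_eqF // Ttr_norm_gt0.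
    have [[a b] /= Tab] := mx_norm_neq0 T0.
    by move=> h; exists (a, b) => //=; move: h; rewrite {1}/Num.norm /= Tab.
  by move=> [[a b] _ /= h]; apply: lt_le_trans h _; exact: mx_entry_le.
apply: bigcup_open => -[a b] _ /=.
have -> : [set E | c < `|Ttr f alpha n theta E a b|] =
  (fun E => `|Ttr f alpha n theta E a b|) @^-1` [set y | c < y] by [].
apply: open_comp; last exact: open_gt.
by move=> E _; apply: cvg_norm; exact: ct.
Qed.

Lemma growth_set_measurable m : measurable (growth_set m).
Proof.
(* Integers are written [k - l] so as to intersect over naturals, and the level [-1] makes the
   condition void for small [n]. *)
have -> : growth_set m = \bigcap_(n : nat) \bigcap_(k : nat) \bigcap_(l : nat)
   \bigcup_(x in [set x | (m.+1 <= n)%N -> (x < m.+1 * n ^ 2)%N])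
   [set E | (if (m.+1 <= n)%N then expR (n%:R / m.+1%:R) else -1) <
      `|Ttr f alpha n ((k%:Z - l%:Z + x%:Z)%:~R * alpha) E|].
  apply/seteqP; split=> E.
    move=> h n _ k _ l _; have [mn|mn] := leqP m.+1 n.
      by have [x xm hx] := h n mn (k%:Z - l%:Z); exists x.
    by exists 0%N => //=; exact: lt_le_trans (ltrN10 R) (normr_ge0 _).
  move=> h n mn j.
  have [k [l ->]] : exists k l : nat, j = k%:Z - l%:Z.
    by case: j => k; [exists k, 0%N; rewrite subr0 | exists 0%N, k.+1; rewrite sub0r NegzE].
  have [x /= xm hx] := h n I k I l I; rewrite mn in hx.
  by exists x => //; exact: xm.
apply: bigcapT_measurable => n; apply: bigcapT_measurable => k; apply: bigcapT_measurable => l.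
apply: measurable_realfun.open_measurable; apply: bigcup_open => x _; exact: Ttr_open.
Qed.

Lemma growth_set_mono m p : (m <= p)%N -> growth_set m `<=` growth_set p.
Proof.
move=> mp E h n pn j; have [|x xm hx] := h n _ j; first by apply: leq_trans pn.
exists x; first by apply: leq_trans xm _; rewrite leq_mul2r ltnS mp orbT.
apply: le_lt_trans hx; rewrite ler_expR ler_wpM2l // lef_pV2 ?posrE ?ltr0n //.
by rewrite ler_nat ltnS.
Qed.

(** Continuity of the measure from above: the complements decrease to a subset of the null set where
    the exponent is not positive, and boundedness of the spectrum makes the first one finite. *)
Lemma small_exceptional_set (delta : R) : real_analytic f -> 0 < delta ->
  {ae mu, forall E : R, lyap_pos f alpha E} ->
  exists m : nat, (mu (spec_union f alpha `\` growth_set m) < delta%:E)%E.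
Proof.
move=> af d0 [N [mN N0 NP]].
pose A m := spec_union f alpha `\` growth_set m.
have mS := spec_union_measurable.
have mA m : measurable (A m) by apply: measurableD => //; exact: growth_set_measurable.
have A0 : (mu (A 0%N) < +oo)%E.
  pose c := 18 + 4 * L ^+ 2.
  apply: (@le_lt_trans _ _ (mu `[- c, c]%classic)).
    have sub : A 0%N `<=` `[- c, c]%classic.
      move=> E [/spec_union_approx /approx_eigenvalue_bounded + _].
      by rewrite ler_norml /= in_itv /=.
    apply: le_measure; rewrite ?inE; [exact: (mA 0%N) | by [] | exact: sub].
  by rewrite lebesgue_measure_itv /=; case: ifP => _; rewrite ?ltry // -EFinB ltry.
have mI : measurable (\bigcap_n A n) by exact: bigcapT_measurable.
have Amono : nonincreasing_seq A.
  move=> m p mp; apply/subsetPset => E [SE nG]; split=> // h; apply: nG.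
  exact: growth_set_mono mp _ h.
have cv := nonincreasing_cvg_mu A0 mA mI Amono.
have I0 : mu (\bigcap_n A n) = 0%E.
  apply/eqP; rewrite eq_le measure_ge0 andbT -N0.
  apply: le_measure; rewrite ?inE // => E AE; apply: NP => /= lE.
  have [m m0 mP] := orbit_growth af pf Om lE.
  have [_] := AE m.-1 I; apply; move=> n; rewrite prednK // => mn j.
  exact: mP.
have {}cv : mu \o A @ \oo --> 0%E by rewrite -I0; exact: cv.
have : \forall m \near \oo, (mu (A m) < delta%:E)%E.
  apply: (cv [set y : \bar R | (y < delta%:E)%E]).
  by apply: open_nbhs_nbhs; split; [exact: open_ereal_lt_ereal | rewrite /= lte_fin].
by move=> [m _ h]; exists m; apply: h => /=.
Qed.

End SpectrumSet.

(** * Choice of the dyadic scale *)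

Section Scales.
Variable R : realType.

(** Of the four factors [2 ^ (j / 4)], three absorb the cube and one absorbs [64 C]. *)
Lemma cube_le_pow2 (C j : nat) : (256 * C <= j)%N -> (C * j.+1 ^ 3 <= 2 ^ j)%N.
Proof.
move=> Cj; set i := (j %/ 4)%N.
have ij : (j.+1 <= 4 * i.+1)%N by rewrite /i; lia.
have Ci : (64 * C <= i)%N by rewrite /i; lia.
have i2 : (i.+1 <= 2 ^ i)%N by exact: ltn_expl.
have j3 : (j.+1 ^ 3 <= 64 * i.+1 ^ 3)%N.
  by rewrite -[64%N]/(4 ^ 3)%N -expnMn leq_exp2r.
have p4 : (2 ^ i * (2 ^ i) ^ 3 <= 2 ^ j)%N.
  by rewrite -expnS -expnM leq_pexp2l // /i; lia.
apply: leq_trans p4; apply: leq_trans (leq_mul (leqnn C) j3) _.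
rewrite mulnA; apply: leq_mul; last by rewrite leq_exp2r.
by apply: leq_trans (ltnW i2); rewrite mulnC.
Qed.

(* [2 ^ j] is of order [k ^ (3/2)], which dominates [k * j]. *)
Lemma scale_choice (c : nat) : exists2 k0 : R, 1 <= k0 & forall k, k0 <= k ->
  exists j : nat, ((2 ^ j) ^ 2)%:R <= k ^+ 3 /\ c%:R * (1 + k * j%:R) <= (2 ^ j)%:R.
Proof.
pose D := (4 * c ^ 3)%N.
exists ((4 ^ (256 * D))%:R : R); first by rewrite ler1n expn_gt0.
move=> k kk; have k1 : 1 <= k by apply: le_trans kk; rewrite ler1n expn_gt0.
have kc : 1 <= k ^+ 3 by exact: exprn_ege1.
have /andP[t1 t2] := truncn_itv (le_trans ler01 kc).
set t := Num.truncn (k ^+ 3) in t1 t2.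
have t0 : (0 < t)%N by rewrite -(ltr_nat R); have := t2; rewrite -natr1; lra.
have /andP[h1 h2] := trunc_log_bounds (isT : (1 < 4)%N) t0.
(* This is [4 ^ j <= k ^ 3 < 4 ^ j.+1], so [2 ^ j] agrees with [k ^ (3/2)] up to a factor [2]. *)
set j := trunc_log 4 t in h1 h2; exists j.
have jk : k ^+ 3 < (4 ^ j.+1)%:R by apply: lt_le_trans t2 _; rewrite ler_nat.
split; first by apply: le_trans t1; rewrite ler_nat -expnM mulnC expnM.
have jD : (256 * D <= j)%N.
  rewrite -ltnS -(ltn_exp2l _ _ (isT : (1 < 4)%N)) -(ltr_nat R).
  apply: (le_lt_trans _ jk); apply: le_trans kk _; rewrite exprS ler_peMr //.
    exact: le_trans ler01 k1.
  exact: exprn_ege1.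
have big := cube_le_pow2 jD.
rewrite leNgt; apply/negP => lt.
have lt2 : (2 ^ j)%:R < c%:R * k * j.+1%:R.
  apply: lt_le_trans lt _; rewrite -mulrA ler_wpM2l // -natr1 mulrDr mulr1 addrC lerD2l //.
(* After cubing, [k] occurs as [k ^ 3 < 4 ^ j.+1], and what remains is
   [4 c ^ 3 (j + 1) ^ 3 <= 2 ^ j]. *)
have : ((2 ^ j)%:R : R) ^+ 3 < (2 ^ j)%:R ^+ 3.
  apply: lt_le_trans (_ : (c%:R * k * j.+1%:R) ^+ 3 <= _).
    by rewrite ltrXn2r // nnegrE (le_trans _ (ltW lt2)).
  rewrite !exprMn; apply: le_trans (_ : c%:R ^+ 3 * (4 ^ j.+1)%:R * j.+1%:R ^+ 3 <= _).
    by rewrite ler_wpM2r ?exprn_ge0 // ler_wpM2l ?exprn_ge0 // ltW.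
  rewrite -!natrX -!natrM ler_nat.
  have -> : (c ^ 3 * 4 ^ j.+1 * j.+1 ^ 3 = D * j.+1 ^ 3 * (2 ^ j) ^ 2)%N.
    have e : (4 ^ j = (2 ^ j) ^ 2)%N by rewrite -[4%N]/(2 ^ 2)%N -!expnM mulnC.
    by rewrite /D [(4 ^ j.+1)%N]expnS e; move: (2 ^ j)%N j.+1 => a b; ring.
  by rewrite [((2 ^ j) ^ 3)%N]expnS leq_mul2r big orbT.
by rewrite ltxx.
Qed.

Lemma sum_window_le (W x l : nat) (g : nat -> R) : (forall i, 0 <= g i) -> (x + l <= W)%N ->
  \sum_(0 <= t < l) g (x + t)%N <= \sum_(0 <= t < W) g t.
Proof.
move=> g0 xW.
have -> : \sum_(0 <= t < l) g (x + t)%N = \sum_(x <= t < x + l) g t.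
  by rewrite -{2}[x]add0n big_addn addKn; apply: eq_bigr => t _; rewrite addnC.
rewrite (big_cat_nat (m := 0) (n := x + l) (p := W)) //= (big_cat_nat (m := 0) (n := x) (p := x + l)) ?leq_addr //=.
by rewrite addrAC addrC lerDl addr_ge0 // sumr_ge0.
Qed.

End Scales.

(** * Localized approximate eigenvectors and change of frequency *)

Section Continuity.
Variables (R : realType) (f : R -> R) (alpha L : R).
Hypothesis fL : forall x, `|f x| <= L.
Hypothesis lip : forall x y, `|f x - f y| <= L * `|x - y|.

Let L0 : 0 <= L. Proof. exact: le_trans (normr_ge0 _) (fL 0). Qed.

(* Growth of the transfer matrices provides a cut in every window of length
   [W], at the cost [kappa = 16 * Lam ^- 2]. *)
Lemma local_approx_eigenvector (m j : nat) (Lam E : R) :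
  approx_eigenvalue f alpha E -> growth_set f alpha m E -> 0 < Lam ->
  (m.+1 <= 2 ^ j)%N -> (L + `|E| + 1) * Lam ^+ j <= expR ((2 ^ j)%:R / m.+1%:R) ->
  exists (a : int) chi, [/\ fsupp chi, 0 < nrm2 chi,
    nrm2 (hop (pot f alpha 0 E) chi) <= 128 * Lam ^- 2 * nrm2 chi &
    forall n, chi n != 0 -> a <= n < a + (2 * (m.+1 * (2 ^ j) ^ 2 + 2 ^ j + 1))%N%:Z].
Proof.
move=> app gr Lam0 mj big; set v := pot f alpha 0 E; set N := (2 ^ j)%N in mj big *.
(* The search for growth takes [m.+1 * N ^ 2] positions and the interval itself [N]. One more site
   is kept free on the left, as [cut_point] reads [psi] at [i - 1]. *)
set W := (m.+1 * N ^ 2 + N + 1)%N.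
have vV n : `|v n| <= L + `|E| by apply: le_trans (ler_normB _ _) _; rewrite lerD2r.
have [C C0 cut] := cut_point vV j Lam0.
pose kappa := 16 * Lam ^- 2.
have k0 : 0 < kappa by rewrite mulr_gt0 // invr_gt0 exprn_gt0.
have C1 : 0 < 3 + 6 * C by lra.
(* Only here, with [C] known, is the approximate eigenvector chosen. *)
have [psi [fpsi psi0 small]] := app _ (divr_gt0 k0 C1).
have W0 : (0 < W)%N by rewrite /W addn1.
have /choice[x xP] : forall k : int, exists x : int, k * W%:Z < x < (k + 1) * W%:Z /\
    psi x ^+ 2 + psi (x - 1) ^+ 2 <= kappa * \sum_(0 <= i < W) psi (k * W%:Z + i%:Z) ^+ 2 +
     C * \sum_(0 <= i < W) hop v psi (k * W%:Z + i%:Z) ^+ 2.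
  move=> k; have [x xm gx] := gr N mj (k * W%:Z + 1).
  have [|y [/andP[y1 y2] yP]] := cut psi (k * W%:Z + 1 + x%:Z).
    by apply: le_lt_trans big _; rewrite tm_Ttr.
  exists y; split.
    move: y1 y2; rewrite -/N mulrDl mul1r; move: (k * W%:Z) => kW.
    by rewrite /W; move: xm; clear; move: (_ * N ^ 2)%N => Y; lia.
  apply: le_trans yP _; apply: lerD.
    rewrite -/kappa ler_pM2l //.
    have := @sum_window_le R W x (N + 2) (fun i => psi (k * W%:Z + i%:Z) ^+ 2).
    rewrite -/N => h; apply: le_trans (h _ _); last 2 first.
    - by move=> i; exact: sqr_ge0.
    - by rewrite /W; move: xm; clear; move: (_ * N ^ 2)%N => Y; lia.
    rewrite le_eqVlt; apply/orP; left; apply/eqP; apply: eq_bigr => t _.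
    by congr (psi _ ^+ 2); rewrite PoszD; ring.
  apply: ler_wpM2l => //.
  have := @sum_window_le R W x.+1 N (fun i => hop v psi (k * W%:Z + i%:Z) ^+ 2).
  rewrite -/N => h; apply: le_trans (h _ _); last 2 first.
  - by move=> i; exact: sqr_ge0.
  - by rewrite /W; move: xm; clear; move: (_ * N ^ 2)%N => Y; lia.
  rewrite le_eqVlt; apply/orP; left; apply/eqP; apply: eq_bigr => t _.
  by congr (hop v psi _ ^+ 2); rewrite -addn1 !PoszD; ring.
have [|a [chi [fchi chi0 hchi supp]]] := @localize R v psi W x kappa C (kappa / (3 + 6 * C)) W0
    (fun k => (xP k).1) (fun k => (xP k).2) k0 C0 _ fpsi psi0 (ltW small).
  by rewrite mulrC divfK ?gt_eqF.
exists a, chi; split=> //; apply: le_trans hchi _.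
by rewrite /kappa mulrA -natrM.
Qed.

Lemma spectrum_near (alpha' E e : R) (a : int) (W : nat) (chi : int -> R) (d : R) :
  fsupp chi -> 0 < nrm2 chi -> 0 <= e ->
  nrm2 (hop (pot f alpha 0 E) chi) <= d * nrm2 chi ->
  (forall n, chi n != 0 -> a <= n < a + W%:Z) ->
  2 * d + 2 * (L * (`|alpha - alpha'| * W%:R)) ^+ 2 <= e ^+ 2 ->
  exists2 E', spec_union f alpha' E' & `|E' - E| <= e.
Proof.
move=> fchi chi0 e0 hchi supp de.
(* With this phase the two potentials agree at the left end [a] of the support, so their phases
   differ by at most [|alpha - alpha'| W] on it, however far away [a] is. *)
pose theta := (alpha - alpha') * a%:~R; pose v' := pot f alpha' theta E.
have v'V n : `|v' n| <= L + `|E| by apply: le_trans (ler_normB _ _) _; rewrite lerD2r.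
have pert : nrm2 (hop v' chi) <= e ^+ 2 * nrm2 chi.
  apply: le_trans (nrm2_hop_perturb (v := pot f alpha 0 E) (d := L * (`|alpha - alpha'| * W%:R)) fchi supp _) _.
    move=> n /= /andP[n1 n2]; rewrite /v' /pot addr0 opprB addrA subrK.
    apply: le_trans (lip _ _) _; apply: ler_wpM2l => //.
    have -> : alpha' * n%:~R + theta - alpha * n%:~R = - ((alpha - alpha') * (n - a)%:~R).
      by rewrite /theta intrB; ring.
    rewrite normrN normrM ler_wpM2l // ger0_norm ?ler0z ?subr_ge0 //.
    by rewrite -[W%:R]/(W%:Z%:~R) ler_int lerBlDl ltW.
  apply: le_trans (_ : _ <= 2 * (d * nrm2 chi) + 2 * ((L * (`|alpha - alpha'| * W%:R)) ^+ 2 * nrm2 chi)) _.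
    by rewrite lerD2r ler_pM2l.
  by have := ler_wpM2r (ltW chi0) de; rewrite mulrDl !mulrA.
have [s se nb] := near_spectrum v'V e0 fchi chi0 pert.
exists (E + s); last by rewrite addrC addKr.
exists theta => /resolvent_bounded_below[eta eta0 low]; apply: (nb eta eta0).
have -> // : (fun n => v' n - s) = pot f alpha' theta (E + s).
by apply/funext => n; rewrite /v' /pot opprD addrA.
Qed.

End Continuity.


(** * The continuity estimate *)

Theorem theorem3 (R : realType) (f : R -> R) (alpha : R) :
  real_analytic f -> periodic1 f -> Omega alpha ->
  {ae (@lebesgue_measure R), forall E : R, lyap_pos f alpha E} ->
  forall delta : R, 0 < delta ->
  exists A : set R,
    [/\ measurable A, A `<=` spec_union f alpha,
        (lebesgue_measure A < delta%:E)%E &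
        exists2 h : R, 0 < h & exists2 c : R, 0 < c &
          forall E : R, spec_union f alpha E -> ~ A E ->
          forall alpha' : R, 0 < `|alpha - alpha'| < h ->
          exists2 E' : R, spec_union f alpha' E' &
            `|E' - E| < c * `|(alpha - alpha') * (ln `|alpha - alpha'|) ^+ 3|].
Proof.
move=> af pf Om ae delta d0.
have [L L0 [fL lip]] := analytic_bounded_lipschitz af pf.
have [m mA] := small_exceptional_set fL lip pf Om af d0 ae.
exists (spec_union f alpha `\` growth_set f alpha m); split=> //.
  apply: measurableD; first exact: spec_union_measurable fL lip pf Om.
  exact: growth_set_measurable.
(* A bound on the norm of a step matrix that is uniform over the spectrum, so that the constants do
   not depend on [E]. *)
pose V1 := L + (18 + 4 * L ^+ 2) + 1.
have V1_ge1 : 1 <= V1 by rewrite /V1; have := sqr_ge0 L; lra.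
(* With this factor [c (1 + k j) <= 2 ^ j] yields [ln V1 + k j <= 2 ^ j / (m + 1)], the growth
   required for [j] halvings with loss [eps^-1 = expR k]. *)
pose c := (m.+1 * (Num.truncn (ln V1)).+2)%N.
have [k0 k01 scale] := scale_choice R c.
(* [G k ^ 3] bounds [L W]. In [c0], [256] is twice the cutting constant [128] and [2 G ^ 2] pays for
   the change of frequency; as [c0 >= 1], [c0 <= c0 ^ 2] spares a square root. *)
pose G := 2 * L * (m + 3)%:R.
pose c0 := 256 + 2 * G ^+ 2.
have c0_ge1 : 1 <= c0 by rewrite /c0; have := sqr_ge0 G; lra.
exists (expR (- k0)); first exact: expR_gt0.
(* Doubling turns the estimate into a strict one. *)
exists (2 * c0); first by rewrite mulr_gt0 // (lt_le_trans ltr01).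
move=> E SE nA alpha' /andP[eps0 epsh].
have app := (spec_union_approx fL lip pf Om E).1 SE.
have gr : growth_set f alpha m E by apply: contrapT => ng; apply: nA.
set eps := `|alpha - alpha'| in eps0 epsh *.
pose k := - ln eps.
have kk : k0 <= k by rewrite /k lerNr -[leRHS]expRK ler_ln ?posrE ?expR_gt0 // ltW.
have k1 : 1 <= k by exact: le_trans kk.
have [j [jk1 jk2]] := scale k kk.
have cj : (c <= 2 ^ j)%N.
  rewrite -(ler_nat R); apply: le_trans jk2; rewrite ler_peMr // lerDl mulr_ge0 //.
  exact: le_trans k1.
have mj : (m.+1 <= 2 ^ j)%N by apply: leq_trans cj; rewrite /c leq_pmulr.
have epsK : expR k = eps^-1 by rewrite /k expRN lnK.
have Lam0 : 0 < expR k by exact: expR_gt0.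
have bE := approx_eigenvalue_bounded fL app.
have big : (L + `|E| + 1) * expR k ^+ j <= expR ((2 ^ j)%:R / m.+1%:R).
  apply: le_trans (_ : V1 * expR k ^+ j <= _).
    by rewrite ler_pM2r ?exprn_gt0 // /V1 lerD2r lerD2l.
  rewrite -expRM_natl -[V1]lnK ?posrE ?(lt_le_trans ltr01) // -expRD ler_expR.
  rewrite ler_pdivlMr ?ltr0n //; apply: le_trans jk2.
  rewrite /c natrM mulrC -mulrA ler_pM2l ?ltr0n //.
  have lt := ltW (truncnS_gt (ln V1)).
  have j0 : 0 <= k * j%:R by rewrite mulr_ge0 // (le_trans _ k1).
  rewrite -natr1 mulrDr mulr1 [j%:R * k]mulrC.
  set T := (Num.truncn (ln V1)).+1%:R in lt *.
  have T0 : 0 <= T by rewrite /T ler0n.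
  by have := mulr_ge0 T0 j0; nra.
have [a [chi [fchi chi0 hchi supp]]] := local_approx_eigenvector fL app gr Lam0 mj big.
rewrite epsK exprVn invrK in hchi.
set N := (2 ^ j)%N in jk1 jk2 supp.
set W := (2 * _)%N in supp.
have k3 : 1 <= k ^+ 3 by exact: exprn_ege1.
have Wk : W%:R <= 2 * (m + 3)%:R * k ^+ 3.
  apply: le_trans (_ : (2 * (m + 3) * N ^ 2)%N%:R <= _).
    rewrite ler_nat /W -mulnA leq_mul2l /=.
    have N0 : (0 < N)%N by rewrite expn_gt0.
    by move: N0; clear; rewrite expnS expn1; nia.
  by rewrite natrM [(2 * (m + 3))%:R]natrM; apply: ler_wpM2l => //; exact: mulr_ge0.
have [||E' SE' EE'] := @spectrum_near R f alpha L fL lip alpha' E (c0 * (eps * k ^+ 3)) a W chi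
    (128 * eps ^+ 2) fchi chi0 _ hchi supp _.
- by rewrite !mulr_ge0 ?exprn_ge0 // ?(le_trans _ c0_ge1) // ?(ltW eps0) // (le_trans _ k1).
  rewrite -/eps.
  have h1 : L * (eps * W%:R) <= G * (eps * k ^+ 3).
    have -> : G * (eps * k ^+ 3) = L * (eps * (2 * (m + 3)%:R * k ^+ 3)) by rewrite /G; ring.
    by rewrite ler_pM2l // ler_pM2l.
  have h2 : (L * (eps * W%:R)) ^+ 2 <= (G * (eps * k ^+ 3)) ^+ 2.
    have p := mulr_ge0 (ltW L0) (mulr_ge0 (ltW eps0) (ler0n R W)).
    by rewrite lerXn2r // nnegrE // (le_trans p).
  have h3 : eps ^+ 2 <= (eps * k ^+ 3) ^+ 2.
    have p : eps <= eps * k ^+ 3 by rewrite ler_peMr // ltW.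
    by rewrite lerXn2r // nnegrE ?(ltW eps0) // (le_trans (ltW eps0)).
  have X0 := sqr_ge0 (eps * k ^+ 3).
  apply: le_trans (_ : c0 * (eps * k ^+ 3) ^+ 2 <= _).
    by rewrite exprMn in h2; rewrite /c0; lra.
  by rewrite [leRHS]exprMn; apply: ler_wpM2r => //; rewrite expr2 ler_peMr // (le_trans _ c0_ge1).
exists E' => //; apply: le_lt_trans EE' _.
have -> : `|(alpha - alpha') * ln eps ^+ 3| = eps * k ^+ 3.
  rewrite normrM -/eps; congr (_ * _).
  by rewrite normrX -normrN -/k ger0_norm // (le_trans _ k1).
have p : 0 < c0 * (eps * k ^+ 3).
  apply: mulr_gt0; first exact: lt_le_trans c0_ge1.
  by apply: mulr_gt0 => //; exact: lt_le_trans k3.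
by rewrite -mulrA; lra.
Qed.
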